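(* Polynomials $X_1,\dots,X_6\in\mathbb{R}_{22}$ satisfy the equation $$X_1^2+X_2^2+X_3^2+X_4^2+X_5^2=X_6^2$$ if and only if, up to an (invertible) linear transformation $\mathbb{R}^6\to\mathbb{R}^6$ preserving this equation (and not depending on the variables $u,v$), we have $$\begin{aligned} X_1+iX_2+jX_3+kX_4&=2ABCD,\\ X_5&=(|B|^2-|AC|^2)D,\\ X_6&=(|B|^2+|AC|^2)D \end{aligned}$$ for some $A,B,C\in\mathbb{H}_{11}$, $D\in\mathbb{R}_{22}$ such that $|B|^2D,\ |AC|^2D\in\mathbb{R}_{22}$.
   Context: $\mathbb{H}$ is the skew field of quaternions. $\mathbb{H}[u,v]$ is the ring of polynomials with quaternionic coefficients, where the variables $u,v$ commute with each other and with the coefficients. $\mathbb{R}_{mn}\subset\mathbb{R}[u,v]$ and $\mathbb{H}_{mn}\subset\mathbb{H}[u,v]$ are the sets of polynomials of degree at most $m$ in $u$ and at most $n$ in $v$. For $A\in\mathbb{H}[u,v]$, $\overline{A}$ is obtained by conjugating all coefficients and $|A|^2:=A\overline{A}\in\mathbb{R}[u,v]$. A linear transformation preserves the equation if it maps the set of solutions of the equation $x_1^2+\dots+x_5^2=x_6^2$ onto itself; ''up to'' such a transformation means that the stated representation holds for the $6$-tuple obtained by applying some such transformation with constant real coefficients to $(X_1,\dots,X_6)$. *)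

(* Defs.v *)
From HB Require Import structures.
From mathcomp Require Import all_boot all_order all_algebra.
From mathcomp Require Import polyXY ring.
From mathcomp Require Import classical_sets reals.

Set Implicit Arguments.
Unset Strict Implicit.
Unset Printing Implicit Defensive.

Import GRing.Theory.
Local Open Scope ring_scope.

Record quat (R : Type) := Quat { qre : R; qim_i : R; qim_j : R; qim_k : R }.

Section QuaternionRing.
Variable R : comNzRingType.
Implicit Types x y z : quat R.

Definition quat_to_prod x : R * R * R * R :=
  (qre x, qim_i x, qim_j x, qim_k x).
Definition quat_of_prod (t : R * R * R * R) : quat R :=
  let: (a, b, c, d) := t in Quat a b c d.
Lemma quat_to_prodK : cancel quat_to_prod quat_of_prod.
Proof. by case. Qed.

HB.instance Definition _ := Choice.copy (quat R) (can_type quat_to_prodK).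

Definition quat_add x y : quat R :=
  Quat (qre x + qre y) (qim_i x + qim_i y) (qim_j x + qim_j y)
       (qim_k x + qim_k y).

Definition quat_opp x : quat R :=
  Quat (- qre x) (- qim_i x) (- qim_j x) (- qim_k x).

Definition quat_mul x y : quat R :=
  let: Quat a b c d := x in
  let: Quat a' b' c' d' := y in
  Quat (a * a' - b * b' - c * c' - d * d')
       (a * b' + b * a' + c * d' - d * c')
       (a * c' - b * d' + c * a' + d * b')
       (a * d' + b * c' - c * b' + d * a').

Fact quat_addA : associative quat_add.
Proof. by move=> x y z; rewrite /quat_add /= !addrA. Qed.
Fact quat_addC : commutative quat_add.
Proof. by move=> x y; congr Quat; apply: addrC. Qed.
Fact quat_add0 : left_id (Quat 0 0 0 0) quat_add.
Proof. by case=> a b c d; rewrite /quat_add /= !add0r. Qed.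
Fact quat_addN : left_inverse (Quat 0 0 0 0) quat_opp quat_add.
Proof. by move=> x; rewrite /quat_add /= !addNr. Qed.

HB.instance Definition _ := GRing.isZmodule.Build (quat R)
  quat_addA quat_addC quat_add0 quat_addN.

Fact quat_mulA : associative quat_mul.
Proof. by move=> [? ? ? ?] [? ? ? ?] [? ? ? ?] /=; congr Quat; ring. Qed.
Fact quat_mul1 : left_id (Quat 1 0 0 0) quat_mul.
Proof. by case=> a b c d /=; congr Quat; ring. Qed.
Fact quat_mulr1 : right_id (Quat 1 0 0 0) quat_mul.
Proof. by case=> a b c d /=; congr Quat; ring. Qed.
Fact quat_mulDl : left_distributive quat_mul +%R.
Proof. by move=> [? ? ? ?] [? ? ? ?] [? ? ? ?]; congr Quat => /=; ring. Qed.
Fact quat_mulDr : right_distributive quat_mul +%R.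
Proof. by move=> [? ? ? ?] [? ? ? ?] [? ? ? ?]; congr Quat => /=; ring. Qed.
Fact quat_1_neq0 : Quat 1 0 0 0 != 0 :> quat R.
Proof. by apply/eqP => -[] /eqP; rewrite oner_eq0. Qed.

HB.instance Definition _ := GRing.Zmodule_isNzRing.Build (quat R)
  quat_mulA quat_mul1 quat_mulr1 quat_mulDl quat_mulDr quat_1_neq0.

Definition qconj x : quat R :=
  Quat (qre x) (- qim_i x) (- qim_j x) (- qim_k x).

Definition qreal (a : R) : quat R := Quat a 0 0 0.

End QuaternionRing.

(* The outer variable of {poly {poly _}} is u and the inner one is v; over a
   noncommutative ring both commute with each other and with the coefficients. *)
Definition bideg_le (S : nzRingType) (m n : nat) (p : {poly {poly S}}) : bool :=
  (size p <= m.+1)%N && (sizeY p <= n.+1)%N.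

Section QuaternionicPolynomials.
Variable R : comNzRingType.
Implicit Types (p : {poly {poly R}}) (A : {poly {poly (quat R)}}).

Definition toH p : {poly {poly (quat R)}} := map_poly (map_poly (@qreal R)) p.

Definition constH (x : quat R) : {poly {poly (quat R)}} := x%:P%:P.

Definition conjH A : {poly {poly (quat R)}} := map_poly (map_poly (@qconj R)) A.

Definition normsqH A : {poly {poly (quat R)}} := A * conjH A.

(* Membership in R_{mn}, seen as a subset of the quaternionic polynomials. *)
Definition in_Rmn (m n : nat) A : Prop := exists2 p, bideg_le m n p & A = toH p.

Definition iH := constH (Quat 0 1 0 0).
Definition jH := constH (Quat 0 0 1 0).
Definition kH := constH (Quat 0 0 0 1).

End QuaternionicPolynomials.

Notation "p %:H" := (toH p) (at level 2, left associativity, format "p %:H")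
  : ring_scope.

Arguments iH {R}.
Arguments jH {R}.
Arguments kH {R}.

(* The coordinates x_1, ..., x_6 have indices 0, ..., 5 in 'I_6. *)
Definition cone_eq (S : comNzRingType) (x : 'cV[S]_6) : Prop :=
  x 0 0 ^+ 2 + x 1 0 ^+ 2 + x 2 0 ^+ 2 + x 3 0 ^+ 2 + x 4 0 ^+ 2 = x 5 0 ^+ 2.

Definition preserves_cone (R : realType) (M : 'M[R]_6) : Prop :=
  ([set M *m x | x in [set x | cone_eq x]] = [set x | cone_eq x])%classic.

Definition polyC2_mx (R : nzRingType) (m n : nat) (M : 'M[R]_(m, n)) :
  'M[{poly {poly R}}]_(m, n) := map_mx (fun a : R => a%:P%:P) M.

(* Main.v *)
From HB Require Import structures.
Require Import Defs.
From mathcomp Require Import all_boot all_order all_algebra.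
From mathcomp Require Import polyXY ring lra complex reals zify classical_sets.

Set Implicit Arguments.
Unset Strict Implicit.
Unset Printing Implicit Defensive.

Import Order.TTheory GRing.Theory Num.Theory.
Local Open Scope ring_scope.

(** Put [p = X6 - X5], [s = X6 + X5] and let [q] be the quaternion with components
    [X1, ..., X4]. The equation becomes the norm equation [p s = |q|^2], which
    says that the Hermitian quaternionic matrix [H] with rows [(p, q)] and
    [(conj q, s)] has rank one. The goal is [q = A B C D], [p = |A C|^2 D],
    [s = |B|^2 D]; the bounds on the bidegrees of the factors follow from those of
    [p] and [s], and the factor 2 is absorbed in [D]. Of the transformations of
    the cone only two kinds are needed: the swap of [p] and [s] with conjugation
    of [q], and the shifts [q |-> q + p z] by a constant quaternion [z].

    Regard [H] as quadratic in [u] with coefficients polynomial in [v]. If the three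
    coefficient vectors span an isotropic subspace, they are proportional, [H] is
    a scalar multiple of a matrix depending on [v] alone, and factorization in one
    variable applies ([degenerate_conic_good]). Otherwise there is a row [(a, b)],
    linear in [u], and a denominator [N], a nonzero polynomial in [v], such that
    [N H] is the product of the conjugate of [(a, b)] with [(a, b)]
    ([conic_row_factor]).

    Now the degree of [N] is lowered ([row_factor_moebius_good]). A real root of [N]
    is a root of the row, and it cancels against a double root of [N] or against a
    common factor of [p], [q] and [s]. At a nonreal root [v0] of [N] the row
    becomes a pencil [r0 + u r1] of complex 2 x 4 matrices of rank at most one, so
    these matrices share their column space or their row space ([pencil]). In the
    first case the row is left divisible by a linear quaternionic polynomial in
    [v], which cancels against [N]. In the second case [r1] is a left multiple of
    [r0] by a real quaternion, and a shift followed by a swap achieves [a = 0] at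
    [v0], while [b] becomes a left multiple of a constant [w]. Then the relations
    [b p = a q] and [b conj(q) = a s] imply [p = 0] and [w conj(q) = 0] at [v0]
    ([constant_row_good]). Consequently [q = q' A(v)] and [p = |A(v)|^2 p'(u)] with
    [p' s = |q'|^2]. Here [p'] does not depend on [v] and [q'] is at most linear in
    [v]; in this situation factors of [p'] can be split off from [q'] one after
    another, on the left or on the right ([one_variable_factor]), and the required
    form results. If no root is left, [N] is constant, and the required form has
    the factors [conj a], [b] and 1.

    For the converse the norm equation for the transformed tuple is a computation, and
    it is carried back to the original one at every real point, where
    the matrix permutes the points of the cone. *)

(** * Quaternions over a commutative ring *)

Section QuaternionAlgebra.
Variable S : comNzRingType.
Implicit Types (x y z : quat S) (a b : S).

Definition normq x : S := qre x ^+ 2 + qim_i x ^+ 2 + qim_j x ^+ 2 + qim_k x ^+ 2.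
Definition dotq x y : S :=
  qre x * qre y + qim_i x * qim_i y + qim_j x * qim_j y + qim_k x * qim_k y.

Lemma quat_ext x y : qre x = qre y -> qim_i x = qim_i y ->
  qim_j x = qim_j y -> qim_k x = qim_k y -> x = y.
Proof. by case: x y => [? ? ? ?] [? ? ? ?] /= -> -> -> ->. Qed.

Lemma quat_addE x y : x + y = Quat (qre x + qre y) (qim_i x + qim_i y)
  (qim_j x + qim_j y) (qim_k x + qim_k y).
Proof. by []. Qed.
Lemma quat_oppE x : - x = Quat (- qre x) (- qim_i x) (- qim_j x) (- qim_k x).
Proof. by []. Qed.
Lemma quat_mulE x y : x * y = Quat
  (qre x * qre y - qim_i x * qim_i y - qim_j x * qim_j y - qim_k x * qim_k y)
  (qre x * qim_i y + qim_i x * qre y + qim_j x * qim_k y - qim_k x * qim_j y)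
  (qre x * qim_j y - qim_i x * qim_k y + qim_j x * qre y + qim_k x * qim_i y)
  (qre x * qim_k y + qim_i x * qim_j y - qim_j x * qim_i y + qim_k x * qre y).
Proof. by case: x y => [? ? ? ?] []. Qed.
Lemma quat_0E : 0 = Quat 0 0 0 0 :> quat S. Proof. by []. Qed.
Lemma quat_1E : 1 = Quat 1 0 0 0 :> quat S. Proof. by []. Qed.

Definition quatE := (quat_addE, quat_oppE, quat_mulE, quat_0E, quat_1E).

Fact qreal_is_zmod_morphism : zmod_morphism (@qreal S).
Proof. by move=> a b; rewrite /qreal !quatE /= oppr0 addr0. Qed.
Fact qreal_is_monoid_morphism : monoid_morphism (@qreal S).
Proof. by split=> // a b; rewrite /qreal !quatE; congr Quat => /=; ring. Qed.
HB.instance Definition _ := GRing.isZmodMorphism.Build S (quat S) (@qreal S)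
  qreal_is_zmod_morphism.
HB.instance Definition _ := GRing.isMonoidMorphism.Build S (quat S) (@qreal S)
  qreal_is_monoid_morphism.

Fact qconj_is_zmod_morphism : zmod_morphism (@qconj S).
Proof. by move=> x y; rewrite /qconj !quatE /=; congr Quat; rewrite opprD. Qed.
HB.instance Definition _ := GRing.isZmodMorphism.Build (quat S) (quat S) (@qconj S)
  qconj_is_zmod_morphism.

End QuaternionAlgebra.

Ltac quat_ring :=
  intros; apply: quat_ext; rewrite /normq /dotq /qreal /qconj ?quatE /=; ring.
Ltac norm_ring :=
  intros; rewrite /normq /dotq /qreal /qconj ?quatE /=; ring.

Section QuaternionIdentities.
Variable S : comNzRingType.
Implicit Types (x y z : quat S) (a b : S).

Lemma qrealC a x : qreal a * x = x * qreal a. Proof. quat_ring. Qed.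
Lemma qrealCA a x y : x * (qreal a * y) = qreal a * (x * y).
Proof. by rewrite mulrA -qrealC mulrA. Qed.
Lemma qconjM x y : qconj (x * y) = qconj y * qconj x. Proof. quat_ring. Qed.
Lemma qconjK : involutive (@qconj S).
Proof. by case=> a b c d; rewrite /qconj /= !opprK. Qed.
Lemma qconj_real a : qconj (qreal a) = qreal a.
Proof. by rewrite /qconj /qreal /= oppr0. Qed.
Lemma mul_qconj x : x * qconj x = qreal (normq x). Proof. quat_ring. Qed.
Lemma qconj_mul x : qconj x * x = qreal (normq x). Proof. quat_ring. Qed.
Lemma normqM x y : normq (x * y) = normq x * normq y. Proof. norm_ring. Qed.
Lemma normq_real a : normq (qreal a) = a ^+ 2. Proof. norm_ring. Qed.
Lemma normq_conj x : normq (qconj x) = normq x. Proof. norm_ring. Qed.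
Lemma normq0 : normq (0 : quat S) = 0. Proof. norm_ring. Qed.
Lemma normq1 : normq (1 : quat S) = 1. Proof. norm_ring. Qed.
Lemma normqD x y : normq (x + y) = normq x + normq y + 2 * dotq x y.
Proof. norm_ring. Qed.
Lemma dotqE x y : qconj x * y + qconj y * x = qreal (2 * dotq x y).
Proof. quat_ring. Qed.

Lemma qreal_inj : injective (@qreal S). Proof. by move=> a b []. Qed.

End QuaternionIdentities.

(** Over an integral domain in which a sum of four squares vanishes only
    trivially, quaternions have no zero divisors; this is preserved by adjoining
    a variable, so it holds for all rings of real polynomials below. *)
Definition anisotropic (S : comNzRingType) := forall x : quat S, normq x = 0 -> x = 0.

Lemma anisotropic_real (F : realDomainType) : anisotropic F.
Proof.
move=> x /eqP; rewrite /normq.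
rewrite !paddr_eq0 ?addr_ge0 ?sqr_ge0 // !sqrf_eq0.
by move=> /andP[/andP[/andP[/eqP x0 /eqP x1] /eqP x2] /eqP x3]; exact: quat_ext.
Qed.

Lemma coef_sqr_top (S : comNzRingType) (p : {poly S}) n :
  (size p <= n.+1)%N -> (p ^+ 2)`_(n + n) = p`_n ^+ 2.
Proof.
move=> pn; have lt_n : (n < (n + n).+1)%N by rewrite ltnS leq_addr.
rewrite !expr2 coefM (bigD1 (Ordinal lt_n)) //= addnK big1 ?addr0 // => i ne.
case: (ltngtP i n) => h.
- by rewrite [X in _ * X]nth_default ?mulr0 //; apply: leq_trans pn _; lia.
- by rewrite nth_default ?mul0r //; apply: leq_trans pn _.
- by case/eqP: ne; apply: val_inj.
Qed.

Definition qmap (S T : comNzRingType) (f : S -> T) (x : quat S) : quat T :=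
  Quat (f (qre x)) (f (qim_i x)) (f (qim_j x)) (f (qim_k x)).

Section QuaternionMap.
Variables (S T : comNzRingType) (f : {rmorphism S -> T}).
Implicit Types (x y : quat S).

Fact qmap_is_zmod_morphism : zmod_morphism (qmap f).
Proof. by move=> x y; apply: quat_ext; rewrite /= rmorphB. Qed.
Fact qmap_is_monoid_morphism : monoid_morphism (qmap f).
Proof.
split=> [|x y]; apply: quat_ext; rewrite ?quatE /= ?rmorph0 ?rmorph1 //;
  by rewrite !(rmorphM, rmorphD, rmorphB, rmorphN).
Qed.
HB.instance Definition _ := GRing.isZmodMorphism.Build (quat S) (quat T) (qmap f)
  qmap_is_zmod_morphism.
HB.instance Definition _ := GRing.isMonoidMorphism.Build (quat S) (quat T) (qmap f)
  qmap_is_monoid_morphism.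

Lemma qmap_conj x : qmap f (qconj x) = qconj (qmap f x).
Proof. by apply: quat_ext; rewrite /= ?rmorphN. Qed.
Lemma qmap_real a : qmap f (qreal a) = qreal (f a).
Proof. by apply: quat_ext; rewrite /= ?rmorph0. Qed.
Lemma normq_map x : normq (qmap f x) = f (normq x).
Proof. by rewrite /normq !(rmorphD, rmorphXn). Qed.

End QuaternionMap.

Definition qsize_le (S : comNzRingType) n (x : quat {poly S}) : bool :=
  [&& (size (qre x) <= n)%N, (size (qim_i x) <= n)%N,
      (size (qim_j x) <= n)%N & (size (qim_k x) <= n)%N].

Section Anisotropy.
Variable S : idomainType.
Hypothesis aS : anisotropic S.

Lemma qsize_le_pred n (x : quat {poly S}) :
  qsize_le n.+1 x -> (normq x)`_(n + n) = 0 -> qsize_le n x.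
Proof.
move=> /and4P[s0 s1 s2 s3]; rewrite /normq !coefD !coef_sqr_top // => top0.
have /aS[t0 t1 t2 t3] : normq (qmap (fun p : {poly S} => p`_n) x) = 0 by [].
have drop (p : {poly S}) : (size p <= n.+1)%N -> p`_n = 0 -> (size p <= n)%N.
  move=> pn pn0; apply/leq_sizeP => j; rewrite leq_eqVlt => /orP[/eqP<- //|lt].
  by rewrite nth_default //; apply: leq_trans pn lt.
by apply/and4P; split; apply: drop.
Qed.

(** The leading coefficients of the four squares cannot cancel. *)
Lemma size_normq n (x : quat {poly S}) :
  (size (normq x) <= (n + n).+1)%N -> qsize_le n.+1 x.
Proof.
move=> szN.
have [k] : exists k, qsize_le (n.+1 + k) x.
  exists (maxn (maxn (size (qre x)) (size (qim_i x)))
     (maxn (size (qim_j x)) (size (qim_k x)))).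
  by apply/and4P; split; rewrite (leq_trans _ (leq_addl _ _)) // !leq_max leqnn ?orbT.
elim: k => [|k IH]; first by rewrite addn0.
rewrite addnS => xk; apply: IH; apply: qsize_le_pred => //.
by rewrite nth_default //; apply: leq_trans szN _; lia.
Qed.

Lemma anisotropic_poly : anisotropic {poly S}.
Proof.
move=> x x0; have: qsize_le 0 x.
  by apply: qsize_le_pred; rewrite ?x0 ?coef0 //; apply: size_normq; rewrite x0 size_poly0.
by case/and4P; rewrite !leqn0 !size_poly_eq0 => /eqP? /eqP? /eqP? /eqP?; apply: quat_ext.
Qed.

End Anisotropy.

Lemma qrealI (S : idomainType) (a : S) : a != 0 -> injective (fun x => qreal a * x).
Proof.
move=> a0 x y; rewrite !quatE /qreal /= !mul0r => -[].
rewrite !(addr0, subr0, add0r) => /(mulfI a0)? /(mulfI a0)? /(mulfI a0)? /(mulfI a0)?.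
exact: quat_ext.
Qed.

(** * Rank-one pencils of complexified quaternions *)

Section RealQuaternions.
Variable F : rcfType.
Implicit Types (x y e : quat F).

Lemma normq_eq0 x : (normq x == 0) = (x == 0).
Proof. by apply/eqP/eqP => [/anisotropic_real|->]; rewrite ?normq0. Qed.

Definition qinv x : quat F := qreal (normq x)^-1 * qconj x.

Lemma mulqV x : x != 0 -> x * qinv x = 1.
Proof. by move=> x0; rewrite /qinv qrealCA mul_qconj -rmorphM mulVf ?normq_eq0. Qed.

Lemma mulVq x : x != 0 -> qinv x * x = 1.
Proof. by move=> x0; rewrite /qinv -mulrA qconj_mul -rmorphM mulVf ?normq_eq0. Qed.

Lemma qrealV (a : F) x : a != 0 -> qreal a^-1 * (qreal a * x) = x.
Proof. by move=> a0; rewrite mulrA -rmorphM mulVf ?mul1r. Qed.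

Lemma imag_unit e : e * e = -1 -> qconj e = - e /\ normq e = 1.
Proof.
move=> ee; have ne : normq e = 1.
  have : normq e ^+ 2 = 1 by rewrite expr2 -normqM ee; norm_ring.
  move/eqP; rewrite sqrf_eq1 => /orP[/eqP//|/eqP n1].
  have : 0 <= normq e by rewrite /normq !addr_ge0 ?sqr_ge0.
  by rewrite n1 ler0N1.
split=> //; have := qconj_mul e; rewrite ne => h.
by rewrite -[LHS]mulr1 -[1]opprK -ee mulrN mulrA h mul1r.
Qed.

Local Notation C := F[i].

(** The element [a + i b] of the algebra of quaternions with complex coefficients, where
    [i] is the complex unit and commutes with the quaternion units. *)
Definition cq (a b : quat F) : quat C :=
  Quat (qre a +i* qre b)%C (qim_i a +i* qim_i b)%C (qim_j a +i* qim_j b)%C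
       (qim_k a +i* qim_k b)%C.

Lemma cqP (z : quat C) : exists a b, z = cq a b.
Proof.
exists (qmap (@complex.Re F) z), (qmap (@complex.Im F) z).
by case: z => [[? ?] [? ?] [? ?] [? ?]].
Qed.

Lemma cq_inj a b c d : cq a b = cq c d -> a = c /\ b = d.
Proof. by move=> [? ? ? ? ? ? ? ?]; split; apply: quat_ext. Qed.

Lemma cqM a b c d : cq a b * cq c d = cq (a * c - b * d) (a * d + b * c).
Proof.
by apply: quat_ext; rewrite ?quatE /=; apply/eqP; rewrite eq_complex /=;
  apply/andP; split; apply/eqP; ring.
Qed.
Lemma cqD a b c d : cq a b + cq c d = cq (a + c) (b + d).
Proof. by []. Qed.
Lemma cq_conj a b : qconj (cq a b) = cq (qconj a) (qconj b).
Proof. by []. Qed.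
Lemma cq0 : cq 0 0 = 0.
Proof. by []. Qed.

End RealQuaternions.

Section Pencils.
Variable F : rcfType.
Implicit Types (x y e : quat F).
Local Notation C := F[i].

Lemma mulqI x : x != 0 -> injective (fun y => x * y).
Proof. by move=> x0 y z h; rewrite -[y]mul1r -(mulVq x0) -mulrA h mulrA mulVq ?mul1r. Qed.
Lemma mulIq x : x != 0 -> injective (fun y => y * x).
Proof. by move=> x0 y z h; rewrite -[y]mulr1 -(mulqV x0) mulrA h -mulrA mulqV ?mulr1. Qed.
Lemma qconj_neq0 x : x != 0 -> qconj x != 0.
Proof. by rewrite -!normq_eq0 normq_conj. Qed.

(** For rows [r = (z, y)] and [r' = (z', y')] this is the vanishing of the 2 x 2 matrix
    [r^* r' + r'^* r]; its fourth entry is the conjugate of the second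
    one. *)
Definition row_perp (z y z' y' : quat C) : Prop :=
  [/\ qconj z * z' + qconj z' * z = 0, qconj z * y' + qconj z' * y = 0
    & qconj y * y' + qconj y' * y = 0].

(** [z] is a right multiple of [e + i]. When [e * e = -1] the element [e + i] is a zero
    divisor, as [(e - i) (e + i) = 0]. *)
Definition left_null e (z : quat C) : Prop := exists b, z = cq (e * b) b.

Lemma cq_double_eq0 a b : cq a b + cq a b = 0 :> quat C -> a = 0 /\ b = 0.
Proof.
rewrite cqD -cq0 => /cq_inj[ha hb].
have dbl x : x + x = 0 -> x = 0.
  move=> h; apply: (@qrealI F 2); first by rewrite pnatr_eq0.
  by rewrite mulr0 -h; quat_ring.
by split; apply: dbl.
Qed.

Lemma null_row_head (z y : quat C) : z != 0 ->
  qconj z * z + qconj z * z = 0 -> qconj z * y + qconj z * y = 0 ->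
  exists e, [/\ e * e = -1, left_null e z & left_null e y].
Proof.
have [a [b ->]] := cqP z; have [c [d ->]] := cqP y.
move=> z0; rewrite !cq_conj !cqM => /cq_double_eq0[haa hab] /cq_double_eq0[hac had].
have nab : normq a = normq b.
  by apply: qreal_inj; rewrite -!qconj_mul; apply/eqP; rewrite -subr_eq0 haa.
have b0 : b != 0.
  apply: contra_neq z0 => b0; move/eqP: nab; rewrite b0 normq0 normq_eq0 => /eqP->.
  exact: cq0.
have eb : a * qinv b * b = a by rewrite -mulrA mulVq ?mulr1.
have ee : a * qinv b * (a * qinv b) = -1.
  apply: (mulIq b0); rewrite -mulrA eb mulN1r.
  have -> : a * qinv b * a = qreal (normq b)^-1 * (a * (qconj b * a)).
    by rewrite /qinv !mulrA -(qrealC _ a).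
  have -> : qconj b * a = - (qconj a * b).
    by apply/eqP; rewrite -addr_eq0 addrC hab.
  rewrite mulrN mulrA mul_qconj nab mulrN; congr (- _).
  by rewrite qrealV ?normq_eq0.
have [ce _] := imag_unit ee.
exists (a * qinv b); split=> //; first by exists b; rewrite eb.
exists d; congr cq; apply: (mulqI (qconj_neq0 b0)) => /=.
have -> : qconj b * c = - (qconj a * d) by apply/eqP; rewrite -addr_eq0 addrC had.
by rewrite -{1}eb qconjM ce mulrN mulNr opprK mulrA.
Qed.

(** A row [r] with [r^* r = 0] is a complex 2 x 4 matrix of rank at most one; the element [e]
    records its column space. If [z = a + i b] is nonzero, [e] is the quotient
    [a / b], and the orthogonality of [z] and [y] forces the same quotient on
    [y]. *)
Lemma null_row (z y : quat C) : row_perp z y z y ->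
  exists e, [/\ e * e = -1, left_null e z & left_null e y].
Proof.
case=> hzz hzy hyy; have [z0|z0] := eqVneq z 0; last exact: null_row_head.
have [y0|y0] := eqVneq y 0.
  exists (Quat 0 1 0 0); split; first by quat_ring.
  - by exists 0; rewrite mulr0 cq0.
  - by exists 0; rewrite mulr0 cq0.
have [|e [? ? ?]] := null_row_head (y := z) y0 hyy.
  by rewrite z0 !mulr0 addr0.
by exists e.
Qed.

(** The two ways in which all members of a pencil [r0 + u r1] of complex 2 x 4 matrices can be
    of rank at most one: the same column space, or the same row space. Real quaternions
    act transitively on the nonzero vectors of [C^2], whence the quaternion [c] in the
    second case. *)
Definition pencil_alternative (z0 y0 z1 y1 : quat C) : Prop :=
  (exists e, e * e = -1 /\ [/\ left_null e z0, left_null e y0, left_null e z1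
     & left_null e y1]) \/
  (exists2 c : quat F, z1 = cq c 0 * z0 & y1 = cq c 0 * y0).

Lemma pencil_head (z0 y0 z1 y1 : quat C) : z0 != 0 ->
  row_perp z0 y0 z0 y0 -> row_perp z0 y0 z1 y1 -> row_perp z1 y1 z1 y1 ->
  pencil_alternative z0 y0 z1 y1.
Proof.
move=> z0n r00 r01 r11.
have [e0 [ee0 [x zx] [h yh]]] := null_row r00.
have [e1 [ee1 [xi zxi] [eta yeta]]] := null_row r11.
have [e01|e01] := eqVneq e0 e1.
  left; exists e0; split=> //.
  by split; [exists x | exists h | exists xi; rewrite e01 | exists eta; rewrite e01].
right; have [ce0 _] := imag_unit ee0; have [ce1 _] := imag_unit ee1.
have x0 : x != 0 by apply: contra_neq z0n => x0; rewrite zx x0 mulr0 cq0.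
have [k kE] : exists k, k = e1 - e0 by exists (e1 - e0).
have k0 : k != 0 by rewrite kE subr_eq0 eq_sym.
have [c xic] : exists c, xi = c * x.
  by exists (xi * qinv x); rewrite -mulrA mulVq ?mulr1.
have prod (a b : quat F) :
    qconj (cq (e0 * a) a) * cq (e1 * b) b
      = cq (- (qconj a * (e0 * k) * b)) (qconj a * k * b).
  rewrite cq_conj cqM qconjM ce0 kE mulrBr ee0 opprK; congr cq.
    by rewrite !(mulrDr, mulrDl, mulrN, mulNr, mulr1, mulrA, opprD).
  by rewrite !(mulrBr, mulrBl, mulrDl, mulrN, mulNr, mulrA) addrC.
have prod' (a b : quat F) :
    qconj (cq (e1 * b) b) * cq (e0 * a) a
      = cq (- (qconj b * (k * e0) * a)) (- (qconj b * k * a)).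
  rewrite cq_conj cqM qconjM ce1 kE mulrBl ee0 opprK; congr cq.
    by rewrite !(mulrDr, mulrDl, mulrN, mulNr, mulr1, mulrA, opprD).
  by rewrite !(mulrBr, mulrBl, mulrDl, mulrN, mulNr, mulrA, opprB, opprD, opprK) addrC.
case: r01 => r1 r2 _.
move: r1; rewrite zx zxi prod prod' cqD -cq0 => /cq_inj[m1 m2].
move: r2; rewrite zx zxi yeta yh prod prod' cqD -cq0 => /cq_inj[_ m3].
(* The next two steps say that [k * c] is imaginary and anticommutes with [e0]. *)
have kc : k * c = qconj c * k.
  apply: (mulIq x0); apply: (mulqI (qconj_neq0 x0)) => /=.
  by move/eqP: m2; rewrite subr_eq0 xic qconjM !mulrA => /eqP.
have ec : e1 * c = c * e0.
  apply: (mulqI k0) => /=.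
  have e0k : e0 * k = - (k * e1).
    by rewrite kE mulrBr mulrBl ee0 ee1 opprB addrC opprK addrC.
  have : e0 * k * c + qconj c * k * e0 = 0.
    apply: (mulIq x0); apply: (mulqI (qconj_neq0 x0)) => /=.
    rewrite mul0r mulr0; move/eqP: m1; rewrite -opprD oppr_eq0 xic qconjM.
    by move/eqP; rewrite mulrDl mulrDr !mulrA.
  rewrite -kc e0k mulNr addrC => /eqP; rewrite subr_eq0 => /eqP.
  by rewrite -!mulrA.
have etah : eta = c * h.
  apply: (mulqI k0); apply: (mulqI (qconj_neq0 x0)) => /=.
  move/eqP: m3; rewrite subr_eq0 xic qconjM => /eqP m3.
  by rewrite mulrA m3 -(mulrA (qconj x)) -kc !mulrA.
exists c.
  by rewrite cqM !mul0r subr0 addr0 xic !mulrA ec.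
by rewrite cqM !mul0r subr0 addr0 etah !mulrA ec.
Qed.

Lemma pencil (z0 y0 z1 y1 : quat C) :
  row_perp z0 y0 z0 y0 -> row_perp z0 y0 z1 y1 -> row_perp z1 y1 z1 y1 ->
  pencil_alternative z0 y0 z1 y1.
Proof.
move=> r00 r01 r11; have [z00|z0n] := eqVneq z0 0; last exact: pencil_head.
have [y00|y0n] := eqVneq y0 0.
  have [e [ee ? ?]] := null_row r11; left; exists e; split=> //; split=> //.
    by exists 0; rewrite mulr0 cq0.
  by exists 0; rewrite mulr0 cq0.
have sym (z y z' y' : quat C) : row_perp z y z' y' -> row_perp y z y' z'.
  case=> h1 h2 h3; split=> //; have := congr1 (@qconj _) h2.
  by rewrite raddfD raddf0 /= !qconjM !qconjK addrC.
case: (pencil_head y0n (sym _ _ _ _ r00) (sym _ _ _ _ r01) (sym _ _ _ _ r11)).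
  by case=> e [ee [? ? ? ?]]; left; exists e.
by case=> c ? ?; right; exists c.
Qed.

End Pencils.

(** * Evaluation at a complex point and division by linear factors *)

Section ComplexEvaluation.
Variable F : rcfType.
Implicit Types (s t : F) (f : {poly F}) (x : quat {poly F}) (e : quat F).
Local Notation C := F[i].

Definition ceval (v : C) f : C := (map_poly (real_complex F) f).[v].

Fact ceval_is_zmod_morphism v : zmod_morphism (ceval v).
Proof. by move=> f g; rewrite /ceval rmorphB hornerD hornerN. Qed.
Fact ceval_is_monoid_morphism v : monoid_morphism (ceval v).
Proof. by split=> [|f g]; rewrite /ceval ?rmorph1 ?hornerC // rmorphM hornerM. Qed.
HB.instance Definition _ v := GRing.isZmodMorphism.Build {poly F} C (ceval v)
  (ceval_is_zmod_morphism v).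
HB.instance Definition _ v := GRing.isMonoidMorphism.Build {poly F} C (ceval v)
  (ceval_is_monoid_morphism v).

Lemma cevalC v a : ceval v a%:P = (a +i* 0)%C.
Proof. by rewrite /ceval map_polyC hornerC. Qed.
Lemma cevalX v : ceval v 'X = v.
Proof. by rewrite /ceval map_polyX hornerX. Qed.

Definition quadratic s t : {poly F} := ('X - s%:P) ^+ 2 + (t ^+ 2)%:P.

Lemma size_quadratic s t : size (quadratic s t) = 3.
Proof.
have h : size (('X - s%:P) ^+ 2) = 3 by rewrite size_exp_XsubC.
by rewrite size_polyDl h // (leq_ltn_trans (size_polyC_leq1 _)).
Qed.

Lemma quadratic_neq0 s t : quadratic s t != 0.
Proof. by rewrite -size_poly_eq0 size_quadratic. Qed.

Lemma ceval_quadratic s t : ceval (s +i* t)%C (quadratic s t) = 0.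
Proof.
rewrite rmorphD rmorphXn rmorphB /= !cevalC cevalX.
by apply/eqP; rewrite eq_complex /=; apply/andP; split; apply/eqP; ring.
Qed.

Lemma ceval_eq0 s t f : t != 0 -> ceval (s +i* t)%C f = 0 -> quadratic s t %| f.
Proof.
move=> t0 fv; rewrite /dvdp -size_poly_eq0; set r := f %% _.
have rv : ceval (s +i* t)%C r = 0.
  have := congr1 (ceval (s +i* t)%C) (divp_eq f (quadratic s t)).
  by rewrite rmorphD rmorphM /= ceval_quadratic mulr0 add0r fv.
have rs : (size r <= 2)%N.
  by have := ltn_modp f (quadratic s t); rewrite quadratic_neq0 size_quadratic ltnS.
have rE : r = (r`_0)%:P + (r`_1)%:P * 'X.
  apply/polyP => i; rewrite coefD coefC coefMX coefC.
  case: i => [|[|i]] /=; rewrite ?addr0 ?add0r //.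
  by rewrite nth_default // (leq_trans rs).
move: rv; rewrite rE rmorphD rmorphM /= !cevalC cevalX => /eqP.
rewrite eq_complex /= !(mul0r, subr0, addr0, add0r) => /andP[/eqP h0].
rewrite mulf_eq0 (negbTE t0) orbF => /eqP h1; move: h0; rewrite h1 mul0r addr0 => h0.
by rewrite h0 mul0r addr0 size_poly0.
Qed.

Lemma nonconst_factor f : (1 < size f)%N ->
  (exists c, root f c) \/ exists s t, t != 0 /\ quadratic s t %| f.
Proof.
move=> f1; have /closed_rootP[[s t] /eqP] : size (map_poly (real_complex F) f) != 1.
  by rewrite size_map_poly; case: (size f) f1 => [|[]].
have [->|t0] := eqVneq t 0; last by move=> h; right; exists s, t; split=> //; exact: ceval_eq0.
have -> : (s +i* 0)%C = real_complex F s by [].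
by rewrite horner_map => -[fs]; left; exists s; apply/eqP.
Qed.

(** [div] is whatever criterion of divisibility by [D] is at hand for scalars. *)
Lemma qdiv_ex (K : idomainType) (x : quat K) (D : K) (div : K -> Prop) :
  (forall a, div a -> exists b, a = D * b) ->
  div (qre x) -> div (qim_i x) -> div (qim_j x) -> div (qim_k x) ->
  exists y, x = qreal D * y.
Proof.
move=> H /H[a ha] /H[b hb] /H[c hc] /H[d hd]; exists (Quat a b c d).
by apply: quat_ext; rewrite ?quatE /= ?ha ?hb ?hc ?hd; ring.
Qed.

Lemma dvdp_ex (D a : {poly F}) : D %| a -> exists b, a = D * b.
Proof. by case/dvdpP => b ->; exists b; rewrite mulrC. Qed.

Lemma qmap_ceval_eq0 s t x : t != 0 -> qmap (ceval (s +i* t)%C) x = 0 ->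
  exists y, x = qreal (quadratic s t) * y.
Proof.
move=> t0 [h0 h1 h2 h3].
by apply: (@qdiv_ex _ _ _ (fun a => quadratic s t %| a)); [exact: dvdp_ex | ..]; exact: ceval_eq0.
Qed.

Lemma qmap_horner_eq0 (c : F) x : qmap (horner_eval c) x = 0 ->
  exists y, x = qreal ('X - c%:P) * y.
Proof.
move=> [h0 h1 h2 h3].
apply: (@qdiv_ex _ _ _ (fun a => 'X - c%:P %| a)); [exact: dvdp_ex | ..];
  by rewrite dvdp_XsubCl; apply/eqP.
Qed.

Lemma normq_root (c : F) x : root (normq x) c -> exists y, x = qreal ('X - c%:P) * y.
Proof.
move/eqP => h; apply: qmap_horner_eq0; apply: anisotropic_real.
by rewrite normq_map.
Qed.

Definition linq s t e : quat {poly F} :=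
  qreal ('X - s%:P) + qmap (@polyC F) (qreal t * e).

Lemma linq_conj s t e : e * e = -1 -> qconj (linq s t e) = linq s t (- e).
Proof.
move=> /imag_unit[ce _]; rewrite /linq raddfD /= qconj_real -qmap_conj qconjM ce.
by rewrite qconj_real qrealC.
Qed.

Lemma normq_linq s t e : e * e = -1 -> normq (linq s t e) = quadratic s t.
Proof.
move=> ee; apply: qreal_inj; rewrite -mul_qconj linq_conj // /linq mulrN rmorphN.
rewrite mulrDl !mulrBr (qrealC _ (qmap _ _)) addrA subrK -!rmorphM /=.
rewrite mulrA -(mulrA (qreal t)) -(qrealC t e) mulrA -mulrA ee -rmorphM mulrN1.
by rewrite !rmorphN opprK /= qmap_real -rmorphD -!expr2.
Qed.

Lemma linq_kills_null s t e (z : quat C) : e * e = -1 -> left_null e z ->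
  qmap (ceval (s +i* t)%C) (qconj (linq s t e)) * z = 0.
Proof.
move=> ee [b ->]; rewrite linq_conj //.
have -> : qmap (ceval (s +i* t)%C) (linq s t (- e)) = cq (qreal t * - e) (qreal t).
  by apply: quat_ext; rewrite /linq !quatE /= rmorphD ?rmorphB /= ?cevalX !cevalC ?rmorph0;
     apply/eqP; rewrite eq_complex /=; apply/andP; split; apply/eqP; ring.
rewrite cqM -cq0 mulrN mulNr -mulrA (mulrA e) ee mulN1r mulrN opprK subrr.
by rewrite mulNr mulrA addNr.
Qed.

(** If [x] at the point [s + it] is a right multiple of [e + i], then [x] is left divisible
    by the linear polynomial [v - s + t e]: multiplying by the conjugate of the
    latter produces [(-e + i)(e + i) = 0], that is, a multiple of [quadratic s t]. *)
Lemma left_null_divides s t e x : t != 0 -> e * e = -1 ->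
  left_null e (qmap (ceval (s +i* t)%C) x) -> exists y, x = linq s t e * y.
Proof.
move=> t0 ee nx; have nA := normq_linq s t ee.
have [|y hy] := @qmap_ceval_eq0 s t (qconj (linq s t e) * x) t0.
  by rewrite rmorphM /= linq_kills_null.
exists y; apply: (@qrealI _ (quadratic s t)); first exact: quadratic_neq0.
by rewrite /= -{1}nA -mul_qconj -mulrA hy qrealCA.
Qed.

(** The conjugate of [c (e + i) b] is [conj(b) (i - e) conj(c)], and moving [conj(b)] to the
    right of [i - e] gives a right multiple of [e' + i] with [e'] independent of
    [c]. So common right factors are found as common left factors of
    conjugates. *)
Lemma left_null_conj e (z : quat C) : e * e = -1 -> left_null e z ->
  exists2 e', e' * e' = -1 & forall c, left_null e' (qconj (cq c 0 * z)).
Proof.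
move=> ee [b zb]; have [ce _] := imag_unit ee.
have [b0|b0] := eqVneq b 0.
  by exists e => // c; exists 0; rewrite zb b0 !mulr0 cq0 ?mulr0 raddf0.
have [w bw wb] : exists2 w, qconj b * w = 1 & w * qconj b = 1.
  by exists (qinv (qconj b)); rewrite ?mulqV ?mulVq ?qconj_neq0.
exists (- (qconj b * e * w)).
  by rewrite mulNr mulrN opprK !mulrA -(mulrA _ w) wb mulr1 -(mulrA _ e e) ee mulrN1 mulNr bw.
move=> c; exists (qconj b * qconj c); rewrite qconjM zb !cq_conj cqM raddf0 !mulr0 subr0 add0r.
by rewrite qconjM ce !(mulrN, mulNr) -!(mulrA _ w) (mulrA w) wb mul1r.
Qed.

(** Since [(e + i) b = b (f + i)] with [f] the conjugate of [e] by [b], the right annihilator of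
    [w] consists of the right multiples of [- f + i]. *)
Lemma null_annihilator e (w : quat C) : e * e = -1 -> left_null e w -> w != 0 ->
  exists2 e', e' * e' = -1 & forall z, w * z = 0 -> left_null e' z.
Proof.
move=> ee [b wb] w0; have [ce _] := imag_unit ee.
have b0 : b != 0 by apply: contra_neq w0 => b0; rewrite wb b0 mulr0 cq0.
have [b' bb' b'b] : exists2 b', b * b' = 1 & b' * b = 1.
  by exists (qinv b); rewrite ?mulqV ?mulVq.
exists (- (b' * e * b)).
  by rewrite mulNr mulrN opprK !mulrA -(mulrA _ b) bb' mulr1 -(mulrA _ e e) ee mulrN1 mulNr b'b.
move=> y; have [c [d ->]] := cqP y; rewrite wb cqM -cq0 => /cq_inj[_ h].
exists d; congr cq; apply: (mulqI b0) => /=.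
have -> : b * c = - (e * b * d) by apply/eqP; rewrite -addr_eq0 addrC h.
by rewrite mulNr mulrN !mulrA bb' mul1r.
Qed.

End ComplexEvaluation.

(** * Factoring pencils with a one-variable norm factor *)

Section LinearPencils.
Variable K : idomainType.
Implicit Types (q x y : quat K).

Definition qlift x : quat {poly K} := qmap (@polyC K) x.
Definition lin2 q0 q1 : quat {poly K} := qlift q0 + qreal 'X * qlift q1.

Lemma lin2_ex (x : quat {poly K}) : qsize_le 2 x -> exists q0 q1, x = lin2 q0 q1.
Proof.
case: x => a b c d /and4P[/= ha hb hc hd].
exists (Quat a`_0 b`_0 c`_0 d`_0), (Quat a`_1 b`_1 c`_1 d`_1).
have E (p : {poly K}) : (size p <= 2)%N -> p = (p`_0)%:P + 'X * (p`_1)%:P.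
  move=> ps; apply/polyP => i; rewrite coefD coefC coefXM coefC.
  case: i => [|[|i]] /=; rewrite ?addr0 ?add0r //.
  by rewrite nth_default // (leq_trans ps).
by apply: quat_ext; rewrite /lin2 !quatE /= !mul0r !(subr0, addr0, add0r); exact: E.
Qed.

Lemma lin2_mulC q q0 q1 : lin2 (q * q0) (q * q1) = qlift q * lin2 q0 q1.
Proof. by rewrite /lin2 /qlift !rmorphM /= mulrDr qrealCA. Qed.
Lemma lin2_mulCr q q0 q1 : lin2 (q0 * q) (q1 * q) = lin2 q0 q1 * qlift q.
Proof. by rewrite /lin2 /qlift !rmorphM /= mulrDl mulrA. Qed.

Lemma mulr_lin2 x0 x1 y0 y1 : lin2 x0 x1 * lin2 y0 y1 =
  qlift (x0 * y0) + qreal 'X * qlift (x0 * y1 + x1 * y0)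
    + qreal ('X ^+ 2) * qlift (x1 * y1).
Proof.
rewrite /lin2 mulrDl !mulrDr qrealCA -(mulrA (qreal 'X)) -(mulrA (qreal 'X)) qrealCA.
rewrite (mulrA (qreal 'X) (qreal 'X)) -rmorphM -expr2 /qlift.
by rewrite (rmorphD _ (x0 * y1)) /= !rmorphM /= mulrDr !addrA.
Qed.

Lemma qconj_lin2 q0 q1 : qconj (lin2 q0 q1) = lin2 (qconj q0) (qconj q1).
Proof. by rewrite /lin2 /qlift raddfD /= qconjM qconj_real -!qmap_conj qrealC. Qed.

Lemma normq_lin2 q0 q1 : normq (lin2 q0 q1) =
  (normq q0)%:P + 'X * (2 * dotq q0 q1)%:P + 'X ^+ 2 * (normq q1)%:P.
Proof.
apply: qreal_inj; rewrite -qconj_mul qconj_lin2 mulr_lin2 dotqE !qconj_mul.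
by rewrite /qlift !qmap_real -!(rmorphM (@qreal _)) -!(rmorphD (@qreal _)).
Qed.

Lemma coef_quadratic3 (a b c : K) :
  let p := a%:P + 'X * b%:P + 'X ^+ 2 * c%:P in [/\ p`_0 = a, p`_1 = b & p`_2 = c].
Proof.
by split; rewrite !coefD coefC coefXM coefXnM coefC /= ?coefC /= ?addr0 ?add0r.
Qed.

Lemma lin2_norm_coefs (f : K) (s : {poly K}) q0 q1 : f%:P * s = normq (lin2 q0 q1) ->
  [/\ f * s`_0 = normq q0, f * s`_1 = 2 * dotq q0 q1 & f * s`_2 = normq q1].
Proof.
rewrite normq_lin2 => h; rewrite -!coefCM h.
by have [-> -> ->] := coef_quadratic3 (normq q0) (2 * dotq q0 q1) (normq q1).
Qed.

End LinearPencils.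

Section OneVariableFactor.
Variable F : rcfType.
Implicit Types (f : {poly F}) (p s : {poly {poly F}}) (q : quat {poly F}).
Local Notation C := F[i].

Lemma dvd_coefs f s : (forall i, f %| s`_i) -> exists s', s = f%:P * s'.
Proof.
move=> h; exists (\poly_(i < size s) (s`_i %/ f)).
apply/polyP => i; rewrite coefCM coef_poly; case: ltnP => [_|le].
  by rewrite mulrC divpK.
by rewrite mulr0 nth_default.
Qed.

Lemma ceval_row_perp v (z y z' y' : quat {poly F}) :
  qmap (ceval v) (qconj z * z' + qconj z' * z) = 0 ->
  qmap (ceval v) (qconj z * y' + qconj z' * y) = 0 ->
  qmap (ceval v) (qconj y * y' + qconj y' * y) = 0 ->
  row_perp (qmap (ceval v) z) (qmap (ceval v) y) (qmap (ceval v) z') (qmap (ceval v) y').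
Proof. by rewrite /row_perp -!qmap_conj -!rmorphM -!rmorphD. Qed.

Lemma ceval_dvd_eq0 a t (g h : {poly F}) :
  quadratic a t %| g -> ceval (a +i* t)%C (g * h) = 0.
Proof. by case/dvdpP => k ->; rewrite !rmorphM /= ceval_quadratic mulr0 mul0r. Qed.

(** At the complex root the pencil [q0 + u q1] consists of matrices of rank at most one, and the
    two cases of the alternative give a factor on the left or on the
    right. *)
Lemma lin2_quadratic_factor a t f s q0 q1 : t != 0 -> quadratic a t %| f ->
  f%:P * s = normq (lin2 q0 q1) ->
  exists A q0' q1', normq A = quadratic a t /\
    ((q0 = A * q0' /\ q1 = A * q1') \/ (q0 = q0' * A /\ q1 = q1' * A)).
Proof.
move=> t0 df /lin2_norm_coefs[h0 h1 h2].
pose v := (a +i* t)%C; pose z0 := qmap (ceval v) q0; pose z1 := qmap (ceval v) q1.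
have E x y g : qconj x * y + qconj y * x = qreal (f * g) ->
    row_perp (qmap (ceval v) x) 0 (qmap (ceval v) y) 0.
  move=> xy; rewrite -(rmorph0 (qmap (ceval v))); apply: ceval_row_perp.
  - by rewrite xy qmap_real /= (ceval_dvd_eq0 _ df) rmorph0.
  - by rewrite !mulr0 addr0 rmorph0.
  - by rewrite raddf0 !mulr0 addr0 rmorph0.
have [] := @pencil F z0 0 z1 0.
- by apply: (E _ _ (2 * s`_0)); rewrite qconj_mul -h0 -rmorphD; congr qreal; ring.
- by apply: (E _ _ s`_1); rewrite dotqE h1.
- by apply: (E _ _ (2 * s`_2)); rewrite qconj_mul -h2 -rmorphD; congr qreal; ring.
- case=> e [ee [n0 _ n1 _]].
  have [x0 hx0] := left_null_divides t0 ee n0; have [x1 hx1] := left_null_divides t0 ee n1.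
  by exists (linq a t e), x0, x1; split; [exact: normq_linq | left].
- case=> c hz1 _; have [|e [ee n0 _]] := @null_row F z0 0.
    by apply: (E _ _ (2 * s`_0)); rewrite qconj_mul -h0 -rmorphD; congr qreal; ring.
  have [e' ee' nc] := left_null_conj ee n0.
  have [x0 hx0] : exists y, qconj q0 = linq a t e' * y.
    apply: left_null_divides => //; rewrite qmap_conj -/z0.
    by have := nc 1; rewrite -[cq 1 0]/(1 : quat C) mul1r.
  have [x1 hx1] : exists y, qconj q1 = linq a t e' * y.
    by apply: left_null_divides => //; rewrite qmap_conj -/z1 hz1; exact: nc.
  exists (qconj (linq a t e')), (qconj x0), (qconj x1); rewrite normq_conj normq_linq //.
  by split=> //; right; rewrite -!qconjM -hx0 -hx1 !qconjK.
Qed.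

(** Each factor of [f] in one variable is transferred to [q]: irreducible quadratics become
    linear quaternionic factors, a double real root is a scalar factor of [q],
    and a simple real root is common to [f], [q] and [s]. *)
Lemma one_variable_factor f s q0 q1 : f != 0 -> f%:P * s = normq (lin2 q0 q1) ->
  exists (C1 C2 : quat {poly F}) B (d : {poly F}),
    [/\ lin2 q0 q1 = qlift C1 * B * qlift C2 * qreal d%:P,
        f = normq C1 * normq C2 * d & s = normq B * d%:P].
Proof.
have [n] := ubnP (size f); elim: n f s q0 q1 => // n IH f s q0 q1 fn f0 E.
have [f1|f1] := leqP (size f) 1.
  move: f0 E; rewrite (size1_polyC f1); set c := f`_0; rewrite polyC_eq0 => c0 E.
  exists 1, 1, (qreal (c^-1)%:P%:P * lin2 q0 q1), c%:P.
  have cc : (c^-1)%:P%:P * c%:P%:P = 1 :> {poly {poly F}} by rewrite -!rmorphM mulVf.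
  split.
  - by rewrite /qlift rmorph1 mul1r mulr1 -qrealC mulrA -rmorphM mulrC cc rmorph1 mul1r.
  - by rewrite normq1 !mul1r.
  - rewrite normqM normq_real -E; move: (c^-1)%:P%:P c%:P%:P cc => k1 k2 k12.
    have -> : k1 ^+ 2 * (k2 * s) * k2 = (k1 * k2) ^+ 2 * s.
      by rewrite mulrAC exprMn (expr2 k2) !mulrA.
    by rewrite k12 expr1n mul1r.
have [[c fc]|[a [t [t0 df]]]] := nonconst_factor f1; last first.
  have [A [q0' [q1' [nA alt]]]] := lin2_quadratic_factor t0 df E.
  have [f' ff'] := dvdp_ex df.
  have f'0 : f' != 0 by apply: contra_neq f0 => f'0; rewrite ff' f'0 mulr0.
  have sf' : (size f' < n)%N.
    move: fn; rewrite ff' size_mul ?quadratic_neq0 // size_quadratic !addSn add0n /= ltnS.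
    exact: ltnW.
  have nE : normq (lin2 q0 q1) = (quadratic a t)%:P * normq (lin2 q0' q1').
    by case: alt => -[-> ->]; rewrite (lin2_mulC, lin2_mulCr) normqM normq_map nA // mulrC.
  have E' : f'%:P * s = normq (lin2 q0' q1').
    apply: (mulfI (_ : (quadratic a t)%:P != 0)); first by rewrite polyC_eq0 quadratic_neq0.
    by rewrite -nE -E ff' rmorphM mulrA.
  have [C1 [C2 [B [d [e1 e2 e3]]]]] := IH _ _ _ _ sf' f'0 E'.
  case: alt => -[-> ->]; [exists (A * C1), C2, B, d | exists C1, (C2 * A), B, d]; split=> //.
  - by rewrite lin2_mulC e1 /qlift rmorphM /= !mulrA.
  - by rewrite ff' e2 normqM nA; ring.
  - by rewrite lin2_mulCr e1 /qlift rmorphM /= -mulrA qrealC !mulrA.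
  - by rewrite ff' e2 normqM nA; ring.
have [h0 h1 h2] := lin2_norm_coefs E.
have Xc0 : 'X - c%:P != 0 by rewrite polyXsubC_eq0.
have XcC0 : ('X - c%:P)%:P != 0 :> {poly {poly F}} by rewrite polyC_eq0.
have [f' ff'] : exists f', f = ('X - c%:P) * f' by apply: dvdp_ex; rewrite dvdp_XsubCl.
have f'0 : f' != 0 by apply: contra_neq f0 => f'0; rewrite ff' f'0 mulr0.
have sf' : (size f' < n)%N by move: fn; rewrite ff' size_mul // size_XsubC !addSn add0n /= ltnS.
have [q0' q0E] : exists y, q0 = qreal ('X - c%:P) * y.
  by apply: normq_root; rewrite -h0 rootM fc.
have [q1' q1E] : exists y, q1 = qreal ('X - c%:P) * y.
  by apply: normq_root; rewrite -h2 rootM fc.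
have qE : lin2 q0 q1 = qlift (qreal ('X - c%:P)) * lin2 q0' q1' by rewrite q0E q1E lin2_mulC.
have E1 : f'%:P * s = ('X - c%:P)%:P * normq (lin2 q0' q1').
  apply: (mulfI XcC0); rewrite mulrA -rmorphM -ff' E qE normqM /qlift normq_map normq_real.
  by rewrite rmorphXn /= expr2 mulrA.
have [f'c|f'c] := boolP (root f' c).
  have [g fg] : exists g, f' = ('X - c%:P) * g by apply: dvdp_ex; rewrite dvdp_XsubCl.
  have g0 : g != 0 by apply: contra_neq f'0 => g0; rewrite fg g0 mulr0.
  have sg : (size g < n)%N by move: sf'; rewrite fg size_mul // size_XsubC !addSn add0n /= => /ltnW.
  have E2 : g%:P * s = normq (lin2 q0' q1').
    by apply: (mulfI XcC0); rewrite -E1 fg rmorphM mulrA.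
  have [C1 [C2 [B [d [e1 e2 e3]]]]] := IH _ _ _ _ sg g0 E2.
  exists (qreal ('X - c%:P) * C1), C2, B, d; split=> //.
    by rewrite qE e1 /qlift rmorphM /= !mulrA.
  by rewrite ff' fg e2 normqM normq_real; ring.
have [s' ss'] : exists s', s = ('X - c%:P)%:P * s'.
  apply: dvd_coefs => i; rewrite dvdp_XsubCl.
  have /eqP : ((f'%:P * s)`_i).[c] = 0 by rewrite E1 coefCM hornerM hornerXsubC subrr mul0r.
  by rewrite coefCM hornerM mulf_eq0 => /orP[] //; rewrite -[_ == 0]/(root _ _) (negPf f'c).
have E2 : f'%:P * s' = normq (lin2 q0' q1').
  by apply: (mulfI XcC0); rewrite -E1 ss' mulrCA.
have [C1 [C2 [B [d [e1 e2 e3]]]]] := IH _ _ _ _ sf' f'0 E2.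
exists C1, C2, B, (('X - c%:P) * d); split.
- by rewrite qE e1 /qlift qmap_real /= qrealC -!mulrA -rmorphM -rmorphM /= mulrC.
- by rewrite ff' e2; ring.
- by rewrite ss' e3 rmorphM /=; ring.
Qed.

End OneVariableFactor.

(** * Rank-one factorizations and their denominators *)

Section Triples.
Variable F : rcfType.
Local Notation V := {poly F}.
Local Notation U := {poly {poly F}}.
Local Notation C := F[i].
Implicit Types (p s : U) (q : quat U) (N : V) (a b : quat V).

(** The representation of the triple without bounds on bidegrees and with the factor 2 absorbed
    in [D]. *)
Definition good p q s : Prop := exists (A B C : quat U) (D : U),
  [/\ q = A * B * C * qreal D, p = normq A * normq C * D & s = normq B * D].

Definition qcst (z : quat F) : quat U := qlift (qmap (@polyC F) z).

(** Representability up to the transformations generated by swaps and shifts. *)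
Inductive moebius_good : U -> quat U -> U -> Prop :=
| moebius_id p q s : good p q s -> moebius_good p q s
| moebius_swap p q s : moebius_good s (qconj q) p -> moebius_good p q s
| moebius_shift (z : quat F) p q s :
    moebius_good p (q + qreal p * qcst z) (s + 2 * dotq q (qcst z) + normq (qcst z) * p) ->
    moebius_good p q s.

Lemma moebius_scale (f : U) p q s :
  moebius_good p q s -> moebius_good (f * p) (qreal f * q) (f * s).
Proof.
elim=> {p q s} [p q s [A [B [C [D [-> -> ->]]]]]|p q s _ IH|z p q s _ IH].
- apply: moebius_id; exists A, B, C, (f * D); split; [|ring|ring].
  by rewrite (rmorphM _ f) /= qrealCA.
- by apply: moebius_swap; rewrite qconjM qconj_real -qrealC.
- apply: (@moebius_shift z).
  have -> : qreal f * q + qreal (f * p) * qcst z = qreal f * (q + qreal p * qcst z).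
    by rewrite mulrDr rmorphM mulrA.
  have -> // : f * s + 2 * dotq (qreal f * q) (qcst z) + normq (qcst z) * (f * p)
    = f * (s + 2 * dotq q (qcst z) + normq (qcst z) * p) by norm_ring.
Qed.

(** [N] times the Hermitian matrix with entries [p], [q], [s] is the product of the
    conjugate of the row [(a, b)] with this row. *)
Definition row_factor p q s N (a b : quat U) : Prop :=
  [/\ normq a = N%:P * p, qconj a * b = qreal N%:P * q & normq b = N%:P * s].

Lemma row_factor_swap p q s N (a b : quat U) :
  row_factor p q s N a b -> row_factor s (qconj q) p N b a.
Proof.
by case=> h1 h2 h3; split=> //; rewrite -[a]qconjK -qconjM h2 qconjM qconj_real qrealC.
Qed.

Lemma row_factor_shift z p q s N (a b : quat U) : row_factor p q s N a b ->
  row_factor p (q + qreal p * qcst z) (s + 2 * dotq q (qcst z) + normq (qcst z) * p) N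
    a (b + a * qcst z).
Proof.
case=> h1 h2 h3; split=> //.
  by rewrite mulrDr mulrA qconj_mul h1 h2 mulrDr rmorphM mulrA.
rewrite normqD normqM h1 h3.
have -> : dotq b (a * qcst z) = dotq (qconj a * b) (qcst z) by norm_ring.
have -> : dotq (qconj a * b) (qcst z) = N%:P * dotq q (qcst z) by rewrite h2; norm_ring.
ring.
Qed.

Lemma row_factor_rel p q s N (a b : quat U) : N != 0 -> row_factor p q s N a b ->
  [/\ b * qreal p = a * q, b * qconj q = a * qreal s & p * s = normq q].
Proof.
move=> N0 rf; have [h1 h2 h3] := rf; have [_ h2' _] := row_factor_swap rf.
have NU : N%:P != 0 :> U by rewrite polyC_eq0.
split.
- apply: (qrealI NU); rewrite /= -qrealC mulrA -rmorphM /= -h1 -mul_qconj -mulrA h2.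
  by rewrite qrealCA.
- apply: (qrealI NU); rewrite /= -qrealCA -h2' mulrA mul_qconj h3 rmorphM -mulrA.
  by rewrite (qrealC s).
- apply: (mulfI NU); apply: (mulfI NU).
  transitivity (normq (qconj a * b)); last by rewrite h2 normqM normq_real; ring.
  by rewrite normqM normq_conj h1 h3; ring.
Qed.

Lemma good0 q s : normq q = 0 -> good 0 q s.
Proof.
move/(anisotropic_poly (anisotropic_poly (@anisotropic_real F))) => ->.
by exists 0, 1, 1, s; split; rewrite ?normq0 ?normq1 ?mul0r ?mul1r.
Qed.

Definition ydeg_le n p : Prop := forall i, (size (p`_i)%R <= n)%N.

Lemma ydeg_le_factor n f p : f != 0 -> ydeg_le n (f%:P * p) -> ydeg_le n p.
Proof.
move=> f0 h i; have [->|pi0] := eqVneq p`_i 0; first by rewrite size_poly0.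
apply: leq_trans (h i); rewrite coefCM size_mul //.
by case: (size f) (size_poly_gt0 f) => [|k _]; rewrite ?f0 //= leq_addl.
Qed.

Definition triple_in (P : U -> Prop) p q s : Prop :=
  [/\ P p, [/\ P (qre q), P (qim_i q), P (qim_j q) & P (qim_k q)] & P s].

Definition subspace (P : U -> Prop) : Prop :=
  (forall p s, P p -> P s -> P (p + s)) /\ (forall c p, P p -> P (c%:P%:P * p)).

Lemma subspace_ydeg n : subspace (ydeg_le n).
Proof.
split=> [p s hp hs i|c p hp i].
  by rewrite coefD (leq_trans (size_polyD _ _)) // geq_max hp hs.
by rewrite coefCM mul_polyC (leq_trans (size_scale_leq _ _)).
Qed.

Lemma subspace_size n : subspace (fun p => size p <= n)%N.
Proof.
split=> [p s hp hs|c p hp].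
  by rewrite (leq_trans (size_polyD _ _)) // geq_max hp hs.
by rewrite mul_polyC (leq_trans (size_scale_leq _ _)).
Qed.

Lemma triple_in_swap P p q s : subspace P -> triple_in P p q s -> triple_in P s (qconj q) p.
Proof.
case=> _ PZ [? [? ? ? ?] ?]; split=> //.
have PN r : P r -> P (- r) by move/(PZ (-1)); rewrite !rmorphN !rmorph1 mulN1r.
by split=> //; exact: PN.
Qed.

Lemma triple_in_shift P z p q s : subspace P -> triple_in P p q s ->
  triple_in P p (q + qreal p * qcst z) (s + 2 * dotq q (qcst z) + normq (qcst z) * p).
Proof.
case=> PD PZ [hp [h0 h1 h2 h3] hs].
have E : q + qreal p * qcst z = Quat (qre q + (qre z)%:P%:P * p)
   (qim_i q + (qim_i z)%:P%:P * p) (qim_j q + (qim_j z)%:P%:P * p)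
   (qim_k q + (qim_k z)%:P%:P * p) by quat_ring.
have E' : s + 2 * dotq q (qcst z) + normq (qcst z) * p =
   s + (qre (qreal 2 * z))%:P%:P * qre q + (qim_i (qreal 2 * z))%:P%:P * qim_i q
     + (qim_j (qreal 2 * z))%:P%:P * qim_j q + (qim_k (qreal 2 * z))%:P%:P * qim_k q
     + (normq z)%:P%:P * p by norm_ring.
rewrite E E'; split=> //; last by do 5?[apply: (PD); last exact: PZ].
by split; apply: PD => //; exact: PZ.
Qed.

End Triples.

Section Descent.
Variable F : rcfType.
Local Notation V := {poly F}.
Local Notation U := {poly {poly F}}.
Local Notation C := F[i].
Implicit Types (s t : F) (p r : U) (q Q : quat U) (N : V) (a b x : quat V).

Definition coefq i Q : quat V := qmap (fun p : U => p`_i) Q.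

Lemma coefq_conj i Q : coefq i (qconj Q) = qconj (coefq i Q).
Proof. by apply: quat_ext; rewrite /= ?coefN. Qed.
Lemma coefq_real i p : coefq i (qreal p) = qreal p`_i.
Proof. by apply: quat_ext; rewrite /= ?coef0. Qed.
Lemma coefqD i Q Q' : coefq i (Q + Q') = coefq i Q + coefq i Q'.
Proof. by apply: quat_ext; rewrite !quatE /= coefD. Qed.
Lemma coefq_liftM i x Q : coefq i (qlift x * Q) = x * coefq i Q.
Proof. by apply: quat_ext; rewrite !quatE /= !(coefD, coefB, coefN, coefCM). Qed.
Lemma coefq_XM i Q : coefq i (qreal 'X * Q) = if i is j.+1 then coefq j Q else 0.
Proof.
have -> : qreal 'X * Q = Quat ('X * qre Q) ('X * qim_i Q) ('X * qim_j Q) ('X * qim_k Q).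
  by quat_ring.
by case: i => [|i]; apply: quat_ext; rewrite /= coefXM.
Qed.
Lemma coefq_lin2M i a b Q : coefq i (lin2 a b * Q) =
  a * coefq i Q + (if i is j.+1 then b * coefq j Q else 0).
Proof.
rewrite /lin2 mulrDl coefqD coefq_liftM -mulrA coefq_XM.
by case: i => // i; rewrite coefq_liftM.
Qed.

Lemma coefq_lin2 i a b :
  coefq i (lin2 a b) = if i is j.+1 then (if j is 0 then b else 0) else a.
Proof.
have c1 j : coefq j 1 = if j is 0 then 1 else 0.
  by rewrite coefq_real; case: j => [|j]; rewrite coefC.
rewrite -[lin2 a b]mulr1 coefq_lin2M !c1.
by case: i => [|[|i]]; rewrite ?c1 ?mulr1 ?mulr0 ?addr0 ?add0r.
Qed.
Lemma coefq_inj Q Q' : (forall i, coefq i Q = coefq i Q') -> Q = Q'.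
Proof.
by move=> h; apply: quat_ext; apply/polyP => i; case: (h i).
Qed.

(** If [w + u c w] annihilates [Q], the coefficients of the powers of [u] show successively that
    [w] does. *)
Lemma pencil_annihilates v b0 b1 c Q :
    qmap (ceval v) b1 = cq c 0 * qmap (ceval v) b0 ->
    (forall i, qmap (ceval v) (coefq i (lin2 b0 b1 * Q)) = 0) ->
  forall i, qmap (ceval v) b0 * qmap (ceval v) (coefq i Q) = 0.
Proof.
move=> b1E h; elim=> [|i IH]; first by have := h 0; rewrite coefq_lin2M addr0 rmorphM.
have := h i.+1; rewrite coefq_lin2M rmorphD !rmorphM /= b1E -mulrA IH mulr0 addr0 //.
Qed.

Lemma coefq_dvd s t Q : t != 0 ->
  (forall i, qmap (ceval (s +i* t)%C) (coefq i Q) = 0) ->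
  exists Q', Q = qreal (quadratic s t)%:P * Q'.
Proof.
move=> t0 h; apply: (@qdiv_ex _ _ _ (fun p : U => forall i, quadratic s t %| p`_i)).
- by move=> p /dvd_coefs.
- by move=> i; case: (h i) => h0 h1 h2 h3; apply: ceval_eq0.
- by move=> i; case: (h i) => h0 h1 h2 h3; apply: ceval_eq0.
- by move=> i; case: (h i) => h0 h1 h2 h3; apply: ceval_eq0.
- by move=> i; case: (h i) => h0 h1 h2 h3; apply: ceval_eq0.
Qed.

Lemma coefq_left_factor s t e Q : t != 0 -> e * e = -1 ->
  (forall i, left_null e (qmap (ceval (s +i* t)%C) (coefq i Q))) ->
  exists Q', Q = qlift (linq s t e) * Q'.
Proof.
move=> t0 ee h; have nA := normq_linq s t ee.
have [|Q' hQ] := @coefq_dvd s t (qlift (qconj (linq s t e)) * Q) t0.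
  by move=> i; rewrite coefq_liftM rmorphM /= linq_kills_null.
exists Q'; apply: (@qrealI _ (quadratic s t)%:P); first by rewrite polyC_eq0 quadratic_neq0.
rewrite /= -qrealCA -hQ mulrA /qlift -rmorphM /= mul_qconj nA.
by rewrite qmap_real.
Qed.

(** A factor depending on the inner variable only, extracted from [p] and [q], leaves a norm
    equation whose first factor depends on the outer variable only; after exchanging
    the two variables it is covered by the one-variable factor lemma. *)
Lemma outer_factor_good (f : V) q r : f != 0 -> ydeg_le 3 r ->
  f^:P * r = normq q -> good f^:P q r.
Proof.
move=> f0 ds E; pose sw := qmap (@swapXY F) : quat U -> quat U.
have Esw : f%:P * swapXY r = normq (sw q).
  by rewrite normq_map -E rmorphM /= swapXY_map_polyC.
have szs : (size (swapXY r) <= 3)%N.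
  by rewrite -sizeYE; apply/bigmax_leqP => i _; exact: ds.
have [|q0 [q1 qE]] := @lin2_ex V (sw q).
  apply: (@size_normq V (anisotropic_poly (@anisotropic_real F)) 1).
  rewrite -Esw; apply: leq_trans szs.
  by rewrite mul_polyC size_scale_leq.
rewrite qE in Esw.
have [C1 [C2 [B [d [e1 e2 e3]]]]] := one_variable_factor f0 Esw.
have swK : involutive sw by move=> x; apply: quat_ext; rewrite /= swapXYK.
exists (sw (qlift C1)), (sw B), (sw (qlift C2)), d^:P; split.
- rewrite -[q]swK qE e1 /sw !rmorphM /= (qmap_real _ d%:P) /=.
  by rewrite swapXY_polyC.
- by rewrite /sw /qlift !normq_map /= !swapXY_polyC {1}e2 !rmorphM.
- by rewrite /sw normq_map -[r]swapXYK e3 rmorphM /= swapXY_polyC.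
Qed.

Lemma good_mulr_inner p q r (A : quat V) :
  good p q r -> good ((normq A)%:P * p) (q * qlift A) r.
Proof.
case=> [X [B [Y [D [-> -> ->]]]]]; exists X, B, (Y * qlift A), D; split=> //.
  by rewrite -!mulrA qrealC.
by rewrite normqM normq_map; ring.
Qed.

(** The case in which, at a complex root [s + it] of the denominator, the row [(a, b)] is a
    left multiple of a constant row [(0, w)]. The relations [b p = a q] and
    [b conj(q) = a r] then show that [p] vanishes at [v] and that [w] annihilates
    [conj(q)] there, so that [q] has a linear right factor in the inner variable. *)
Lemma constant_row_good s t p q r N a0 a1 b0 b1 c : t != 0 -> p != 0 ->
    ydeg_le 3 p -> ydeg_le 3 r -> N != 0 ->
    row_factor p q r N (lin2 a0 a1) (lin2 b0 b1) ->
  let ev := qmap (ceval (s +i* t)%C) in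
  ev a0 = 0 -> ev a1 = 0 -> ev b0 != 0 -> ev b1 = cq c 0 * ev b0 ->
  (exists2 e, e * e = -1 & left_null e (ev b0)) -> good p q r.
Proof.
move=> t0 p0 dp dr N0 rf ev za0 za1 zb0 zb1 [e ee nb0].
have [rel1 rel2 pr] := row_factor_rel N0 rf.
have kill Q : (forall i, ev (coefq i (lin2 a0 a1 * Q)) = 0).
  move: za0 za1; rewrite /ev => h0 h1 [|i]; rewrite coefq_lin2M rmorphD ?rmorph0 !rmorphM /=;
    by rewrite h0 ?h1 !mul0r addr0.
have [p' pE] : exists p', p = (quadratic s t)%:P * p'.
  apply: dvd_coefs => i; apply: ceval_eq0 => //.
  have /(pencil_annihilates zb1)/(_ i) :
    forall i, ev (coefq i (lin2 b0 b1 * qreal p)) = 0 by rewrite rel1.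
  rewrite coefq_real qmap_real -qrealC => h; apply/eqP; apply: contraNT zb0 => ne.
  by apply/eqP; apply: (qrealI ne); rewrite mulr0.
have [e' ee' ann] := null_annihilator ee nb0 zb0.
have [y yE] : exists y, qconj q = qlift (linq s t e') * y.
  apply: coefq_left_factor => // i; apply: ann.
  by move: i; apply: (pencil_annihilates zb1); rewrite rel2.
have qE : q = qconj y * qlift (qconj (linq s t e')).
  by rewrite -[q]qconjK yE qconjM /qlift qmap_conj.
have nA : normq (qconj (linq s t e')) = quadratic s t by rewrite normq_conj normq_linq.
have Q0 := quadratic_neq0 s t.
have p'0 : p' != 0 by apply: contra_neq p0 => h; rewrite pE h mulr0.
have [f fE] : exists f : V, p' = f^:P.
  exists (\poly_(i < size p') p'`_i`_0); apply/polyP => i.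
  rewrite coef_map coef_poly; case: ltnP => [_|le]; last by rewrite nth_default.
  apply: size1_polyC.
  have := dp i; rewrite pE coefCM.
  have [->|pi0] := eqVneq p'`_i 0; first by rewrite size_poly0.
  by rewrite size_mul // size_quadratic !addSn add0n.
rewrite qE pE -nA; apply: good_mulr_inner; rewrite fE; apply: outer_factor_good => //.
  by apply: contra_neq p'0 => f0; rewrite fE f0 rmorph0.
rewrite -fE; apply: (mulfI (_ : (quadratic s t)%:P != 0)); first by rewrite polyC_eq0.
by rewrite mulrA -pE pr qE normqM /qlift normq_map nA mulrC.
Qed.

End Descent.

Section DenominatorDescent.
Variable F : rcfType.
Local Notation V := {poly F}.
Local Notation U := {poly {poly F}}.
Local Notation C := F[i].
Implicit Types (p s : U) (q Q : quat U) (N : V).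

Lemma row_factor_cancel (A : quat V) p q s N (a b : quat U) : normq A != 0 ->
  row_factor p q s (normq A * N) (qlift A * a) (qlift A * b) -> row_factor p q s N a b.
Proof.
move=> A0; rewrite /row_factor !normqM /qlift normq_map !rmorphM /= -!mulrA.
have AU : (normq A)%:P != 0 :> U by rewrite polyC_eq0.
case=> /(mulfI AU) h1 h2 /(mulfI AU) h3; split=> //.
apply: (qrealI AU); rewrite /= -h2 qconjM -!mulrA.
by rewrite (mulrA (qconj (qmap _ A))) qconj_mul normq_map qrealCA.
Qed.

Lemma root_factor_transfer c N p (r : U) : ~~ root N c ->
  N%:P * p = ('X - c%:P)%:P * r -> exists p', p = ('X - c%:P)%:P * p'.
Proof.
move=> Nc E; apply: dvd_coefs => i; rewrite dvdp_XsubCl.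
have /eqP : ((N%:P * p)`_i).[c] = 0 by rewrite E coefCM hornerM hornerXsubC subrr mul0r.
by rewrite coefCM hornerM mulf_eq0 => /orP[] //; rewrite -[_ == 0]/(root _ _) (negPf Nc).
Qed.

(** A real root of the denominator is a root of [a] and [b]. Cancelling it removes a double
    root of the left-hand sides, so a simple root of the denominator must be
    compensated by [p], [q] and [s]. *)
Lemma row_factor_simple_root c p q s N (a b : quat U) : ~~ root N c ->
  row_factor p q s (('X - c%:P) * N) (qlift (qreal ('X - c%:P)) * a)
    (qlift (qreal ('X - c%:P)) * b) ->
  exists p' q' s', [/\ p = ('X - c%:P)%:P * p', q = qreal ('X - c%:P)%:P * q',
    s = ('X - c%:P)%:P * s' & row_factor p' q' s' N a b].
Proof.
move=> Nc; set k := ('X - c%:P)%:P : U.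
have k0 : k != 0 by rewrite polyC_eq0 polyXsubC_eq0.
have -> : qlift (qreal ('X - c%:P)) = qreal k by rewrite /qlift qmap_real.
rewrite /row_factor !normqM normq_real !rmorphM /= -/k expr2 -!mulrA.
case=> /(mulfI k0) h1 h2 /(mulfI k0) h3.
have [p' pE] := root_factor_transfer Nc (esym h1).
have [s' sE] := root_factor_transfer Nc (esym h3).
have h2' : qreal N%:P * q = qreal k * (qconj a * b).
  apply: (qrealI k0); rewrite /= -h2 qconjM qconj_real -!mulrA.
  by rewrite -qrealCA qrealCA.
have [q' qE] : exists q', q = qreal k * q'.
  have comp (f : quat U -> U) : (forall d y, f (qreal d * y) = d * f y) ->
      exists r, N%:P * f q = k * r.
    by move=> hf; exists (f (qconj a * b)); rewrite -!hf h2'.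
  apply: (@qdiv_ex _ _ _ (fun y : U => exists r, N%:P * y = k * r)).
  - by move=> y [r]; exact: root_factor_transfer.
  - by apply: comp => d y; rewrite quatE /=; ring.
  - by apply: comp => d y; rewrite quatE /=; ring.
  - by apply: comp => d y; rewrite quatE /=; ring.
  - by apply: comp => d y; rewrite quatE /=; ring.
exists p', q', s'; split=> //; split.
- by apply: (mulfI k0); rewrite h1 pE mulrCA.
- by apply: (qrealI k0); rewrite /= -h2' qE -qrealCA.
- by apply: (mulfI k0); rewrite h3 sE mulrCA.
Qed.

(** Induction on the degree of the denominator. A real root cancels. At a nonreal root the
    pencil [(a, b)] has rank at most one: if its column space is constant, a
    quaternionic linear factor cancels; if its row space is constant, a Moebius
    transformation makes the row equal to a multiple of [(0, w)]. *)
Lemma row_factor_moebius_good N p q s a0 a1 b0 b1 : N != 0 -> triple_in (ydeg_le 3) p q s ->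
  row_factor p q s N (lin2 a0 a1) (lin2 b0 b1) -> moebius_good p q s.
Proof.
have [n] := ubnP (size N).
elim: n N p q s a0 a1 b0 b1 => // n IH N p q s a0 a1 b0 b1 Nn N0 dg rf.
have [N1|N1] := leqP (size N) 1.
  move: N0 rf; rewrite (size1_polyC N1); set c := N`_0; rewrite polyC_eq0 => c0 [h1 h2 h3].
  have cc : (c^-1)%:P%:P * c%:P%:P = 1 :> U by rewrite -!rmorphM mulVf.
  apply: moebius_id; exists (qconj (lin2 a0 a1)), (lin2 b0 b1), 1, (c^-1)%:P%:P.
  rewrite mulr1 h2 normq_conj h1 h3 normq1; split.
  - by rewrite -qrealC mulrA -rmorphM cc rmorph1 mul1r.
  - by rewrite mulr1 mulrC mulrA cc mul1r.
  - by rewrite mulrC mulrA cc mul1r.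
have [rel1 rel2 ps] := row_factor_rel N0 rf.
have [p0|p0] := eqVneq p 0.
  by apply: moebius_id; rewrite p0; apply: good0; rewrite -ps p0 mul0r.
have [h1 h2 h3] := rf.
have [na0 na01 na1] := lin2_norm_coefs (esym h1).
have [nb0 nb01 nb1] := lin2_norm_coefs (esym h3).
have [[c Nc]|[x [t [t0 dN]]]] := nonconst_factor N1.
  have div (a : quat V) (g : V) : N * g = normq a -> exists y, a = qreal ('X - c%:P) * y.
    by move=> h; apply: normq_root; rewrite -h rootM Nc.
  have [a0' a0E] := div _ _ na0; have [a1' a1E] := div _ _ na1.
  have [b0' b0E] := div _ _ nb0; have [b1' b1E] := div _ _ nb1.
  have Xc0 : 'X - c%:P != 0 by rewrite polyXsubC_eq0.
  have [N' NE] : exists N', N = ('X - c%:P) * N' by apply: dvdp_ex; rewrite dvdp_XsubCl.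
  have N'0 : N' != 0 by apply: contra_neq N0 => h; rewrite NE h mulr0.
  have sN' : (size N' < n)%N by move: Nn; rewrite NE size_mul // size_XsubC !addSn add0n /= ltnS.
  move: rf; rewrite a0E a1E b0E b1E !lin2_mulC NE => rf.
  have [N'c|N'c] := boolP (root N' c).
    have [N'' NE'] : exists N'', N' = ('X - c%:P) * N''.
      by apply: dvdp_ex; rewrite dvdp_XsubCl.
    have N''0 : N'' != 0 by apply: contra_neq N'0 => h; rewrite NE' h mulr0.
    have sN'' : (size N'' < n)%N.
      by move: sN'; rewrite NE' size_mul // size_XsubC !addSn add0n /= => /ltnW.
    apply: (IH N'' _ _ _ a0' a1' b0' b1') => //.
    apply: (@row_factor_cancel (qreal ('X - c%:P))); first by rewrite normq_real expf_eq0.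
    by rewrite normq_real expr2 -mulrA -NE'.
  have [p' [q' [s' [pE qE sE rf']]]] := row_factor_simple_root N'c rf.
  rewrite pE qE sE; apply: moebius_scale; apply: IH sN' N'0 _ rf'.
  case: dg; rewrite pE qE sE => dp [d0 d1 d2 d3] ds.
  have D r : ydeg_le 3 (('X - c%:P)%:P * r) -> ydeg_le 3 r by exact: ydeg_le_factor.
  split; [exact: D | split; apply: D | exact: D].
  - by move: d0; rewrite quatE /= !mul0r !subr0.
  - by move: d1; rewrite quatE /= !mul0r !(subr0, addr0).
  - by move: d2; rewrite quatE /= !mul0r !(subr0, addr0).
  - by move: d3; rewrite quatE /= !mul0r !(subr0, addr0).
pose v := (x +i* t)%C; pose ev := qmap (ceval v).
have [N' NE] := dvdp_ex dN.
have N'0 : N' != 0 by apply: contra_neq N0 => h; rewrite NE h mulr0.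
have sN' : (size N' < n)%N.
  by move: Nn; rewrite NE size_mul ?quadratic_neq0 // size_quadratic !addSn add0n /= ltnS => /ltnW.
(* Cancelling a common left factor lowers the degree of the denominator by two. *)
have common_left e : e * e = -1 -> left_null e (ev a0) -> left_null e (ev a1) ->
    left_null e (ev b0) -> left_null e (ev b1) -> moebius_good p q s.
  move=> ee n0 n1 m0 m1.
  have [a0' a0E] := left_null_divides t0 ee n0.
  have [a1' a1E] := left_null_divides t0 ee n1.
  have [b0' b0E] := left_null_divides t0 ee m0.
  have [b1' b1E] := left_null_divides t0 ee m1.
  apply: (IH N' _ _ _ a0' a1' b0' b1') => //.
  apply: (@row_factor_cancel (linq x t e)); rewrite normq_linq ?quadratic_neq0 //.
  by rewrite -NE -!lin2_mulC -a0E -a1E -b0E -b1E.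
have perp i : qmap (ceval v) (qreal (N * i)) = 0.
  by rewrite qmap_real /= (ceval_dvd_eq0 _ dN) rmorph0.
have coefs : [/\ qconj a0 * b0 = qreal N * coefq 0 q,
    qconj a0 * b1 + qconj a1 * b0 = qreal N * coefq 1 q
  & qconj a1 * b1 = qreal N * coefq 2 q].
  have E i : coefq i (qconj (lin2 a0 a1) * lin2 b0 b1) = qreal N * coefq i q.
    by rewrite h2 -coefq_liftM /qlift qmap_real.
  by rewrite -!E qconj_lin2; split; rewrite coefq_lin2M !coefq_lin2 ?mulr0 ?addr0 ?add0r.
have [cf0 cf1 cf2] := coefs.
have perpM z : qmap (ceval v) (qreal N * z) = 0.
  by rewrite rmorphM /= -[N]mulr1 perp mul0r.
have r00 : row_perp (ev a0) (ev b0) (ev a0) (ev b0).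
  apply: ceval_row_perp.
  - by rewrite qconj_mul -na0 -rmorphD -mulrDr perp.
  - by rewrite cf0 -mulrDr perpM.
  - by rewrite qconj_mul -nb0 -rmorphD -mulrDr perp.
have r11 : row_perp (ev a1) (ev b1) (ev a1) (ev b1).
  apply: ceval_row_perp.
  - by rewrite qconj_mul -na1 -rmorphD -mulrDr perp.
  - by rewrite cf2 -mulrDr perpM.
  - by rewrite qconj_mul -nb1 -rmorphD -mulrDr perp.
have r01 : row_perp (ev a0) (ev b0) (ev a1) (ev b1).
  by apply: ceval_row_perp; rewrite ?cf1 ?perpM // dotqE -?na01 -?nb01 perp.
have [[e [ee [? ? ? ?]]]|[c hz1 hy1]] := pencil r00 r01 r11; first exact: (common_left e).
have [e [ee na nb]] := null_row r00.
have [dp dq ds] := dg.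
have [z0|z0] := eqVneq (ev a0) 0.
  have [y0|y0] := eqVneq (ev b0) 0.
    apply: (common_left e) => //; rewrite ?hz1 ?hy1 ?z0 ?y0 mulr0.
    - by exists 0; rewrite mulr0 cq0.
    - by exists 0; rewrite mulr0 cq0.
  apply: moebius_id; apply: (constant_row_good t0 p0 dp ds N0 rf z0 _ y0 hy1).
    by rewrite -/ev hz1 z0 mulr0.
  by exists e.
(* The shift by [z] subtracts from [b] the multiple of [a] equal to it at the root. *)
have [xa zx] := na; have [xb yx] := nb.
have xa0 : xa != 0 by apply: contra_neq z0 => h; rewrite zx h mulr0 cq0.
pose z := - (qinv xa * xb); pose zV := qmap (@polyC F) z.
have xaz : xa * z = - xb by rewrite /z mulrN mulrA mulqV ?mul1r.
have evz : ev zV = cq z 0 by apply: quat_ext; rewrite /= cevalC.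
have b0z : ev (b0 + a0 * zV) = 0.
  rewrite /ev rmorphD rmorphM /= -/ev evz zx yx cqM cqD !mulr0 subr0 add0r -cq0.
  by congr cq; rewrite -?mulrA xaz ?mulrN addrN.
have b1z : ev (b1 + a1 * zV) = 0.
  rewrite /ev rmorphD rmorphM /= -/ev hz1 hy1 -mulrA -mulrDr.
  have -> : ev b0 + ev a0 * ev zV = 0 by rewrite -b0z /ev rmorphD rmorphM.
  by rewrite mulr0.
have rf' := row_factor_swap (row_factor_shift z rf).
have dg' := triple_in_swap (@subspace_ydeg F 3) (triple_in_shift z (@subspace_ydeg F 3) dg).
have lE : lin2 b0 b1 + lin2 a0 a1 * qcst z = lin2 (b0 + a0 * zV) (b1 + a1 * zV).
  by rewrite /lin2 /qlift /qcst !rmorphD !rmorphM mulrDl !mulrDr -!mulrA addrACA.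
rewrite lE in rf'.
apply: (@moebius_shift _ z); apply: moebius_swap; apply: moebius_id.
have [dp' _ ds'] := dg'.
have [s0|s0] := eqVneq (s + 2 * dotq q (qcst z) + normq (qcst z) * p) 0.
  rewrite s0; apply: good0.
  by have [_ _ <-] := row_factor_rel N0 rf'; rewrite s0 mul0r.
apply: (constant_row_good t0 s0 dp' ds' N0 rf' b0z b1z z0 hz1).
by exists e.
Qed.

End DenominatorDescent.

(** * Conics in the outer variable *)

Section QuadraticCurves.
Variable K : comNzRingType.
Implicit Types (x y z w : quat K) (a b c d : K).

Lemma normq_lincomb a b x y : normq (qreal a * x - qreal b * y) =
  a ^+ 2 * normq x + b ^+ 2 * normq y - a * b * (2 * dotq x y).
Proof. norm_ring. Qed.
Lemma dotq_lincomb a b c x y z : 2 * dotq (qreal a * x - qreal b * y) (qreal a * z - qreal c * y) =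
  a ^+ 2 * (2 * dotq x z) - a * c * (2 * dotq y x) - a * b * (2 * dotq y z)
    + 2 * b * c * normq y.
Proof. norm_ring. Qed.

Lemma qconj_mul_trace c x y :
  qreal c * qconj (x * qconj y) = qreal (c * (2 * dotq x y)) - qreal c * (x * qconj y).
Proof.
have -> : 2 * dotq x y = 2 * dotq (qconj x) (qconj y) by norm_ring.
by rewrite rmorphM /= -dotqE !qconjK mulrDr addrC addKr qconjM qconjK.
Qed.
Lemma lincomb_mulr a b c x y :
  (qreal a * x - qreal b * y) * qreal c + qreal (c * b) * y = qreal (c * a) * x.
Proof. by rewrite -qrealC mulrBr !mulrA -!rmorphM subrK. Qed.

Lemma coef_mul_quadratics (p r : {poly K}) : (size p <= 3)%N -> (size r <= 3)%N ->
  [/\ (p * r)`_0 = p`_0 * r`_0, (p * r)`_1 = p`_0 * r`_1 + p`_1 * r`_0,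
      (p * r)`_2 = p`_0 * r`_2 + p`_1 * r`_1 + p`_2 * r`_0,
      (p * r)`_3 = p`_1 * r`_2 + p`_2 * r`_1 & (p * r)`_4 = p`_2 * r`_2].
Proof.
move=> /leq_sizeP ps /leq_sizeP rs.
by split; rewrite coefM !big_ord_recr big_ord0 /= ?add0r;
  rewrite ?(ps 3 isT) ?(ps 4 isT) ?(rs 3 isT) ?(rs 4 isT) ?mulr0 ?mul0r ?addr0 ?add0r.
Qed.

End QuadraticCurves.

Section Conics.
Variable F : rcfType.
Local Notation V := {poly F}.
Local Notation U := {poly {poly F}}.
Implicit Types (p s : U) (q : quat U).

Lemma norm_equation_coefs p q s : triple_in (fun r => size r <= 3)%N p q s ->
    p * s = normq q ->
    let q0 := coefq 0 q in let q1 := coefq 1 q in let q2 := coefq 2 q in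
  [/\ p`_0 * s`_0 = normq q0, p`_0 * s`_1 + p`_1 * s`_0 = 2 * dotq q0 q1,
      p`_0 * s`_2 + p`_1 * s`_1 + p`_2 * s`_0 = normq q1 + 2 * dotq q0 q2,
      p`_1 * s`_2 + p`_2 * s`_1 = 2 * dotq q1 q2 & p`_2 * s`_2 = normq q2].
Proof.
move=> [p3 [d0 d1 d2 d3] s3] E.
have [-> -> -> -> ->] : [/\ p`_0 * s`_0 = (p * s)`_0, p`_0 * s`_1 + p`_1 * s`_0 = (p * s)`_1,
      p`_0 * s`_2 + p`_1 * s`_1 + p`_2 * s`_0 = (p * s)`_2,
      p`_1 * s`_2 + p`_2 * s`_1 = (p * s)`_3 & p`_2 * s`_2 = (p * s)`_4].
  by have [-> -> -> -> ->] := coef_mul_quadratics p3 s3.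
rewrite E /normq /dotq /= !coefD !expr2.
have [-> -> -> -> ->] := coef_mul_quadratics d0 d0.
have [-> -> -> -> ->] := coef_mul_quadratics d1 d1.
have [-> -> -> -> ->] := coef_mul_quadratics d2 d2.
have [-> -> -> -> ->] := coef_mul_quadratics d3 d3.
by split; ring.
Qed.

(** The value of the quadratic form of the cone on the extreme coefficient vectors of the
    triple. By the norm equation it determines the Gram matrix of the three
    coefficient vectors, so its vanishing means that they span an isotropic
    subspace. *)
Definition conic_disc p q s : V :=
  p`_0 * s`_2 + p`_2 * s`_0 - 2 * dotq (coefq 0 q) (coefq 2 q).

Section NormEquation.
Variables (p s : U) (q : quat U).
Hypothesis dx : triple_in (fun r => size r <= 3)%N p q s.
Hypothesis E : p * s = normq q.
Let q0 := coefq 0 q. Let q1 := coefq 1 q. Let q2 := coefq 2 q.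

(** The matrices of the extreme coefficients are multiples of the products of the rows
    [r0 = (p0, q0)] and [r2 = (p2, q2)] with their conjugates. The middle one is
    orthogonal to both, and so it is the mixed term in the product of the row
    [r0 + u l r2] with its conjugate for a suitable quaternion [l]; this is the row
    sought, up to a common denominator. *)
Lemma conic_row_factor : p`_0 != 0 -> p`_2 != 0 -> conic_disc p q s != 0 ->
  exists N a0 a1 b0 b1, N != 0 /\ row_factor p q s N (lin2 a0 a1) (lin2 b0 b1).
Proof.
have [e0 e1 e2 e3 e4] := norm_equation_coefs dx E.
set p0 := p`_0 in e0 e1 e2 *; set p1 := p`_1 in e1 e2 e3; set p2 := p`_2 in e2 e3 e4 *.
set s0 := s`_0 in e0 e1 e2; set s1 := s`_1 in e1 e2 e3; set s2 := s`_2 in e2 e3 e4.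
rewrite -/q0 -/q1 -/q2 in e0 e1 e2 e3 e4.
have gE : conic_disc p q s = p0 * s2 + p2 * s0 - 2 * dotq q0 q2 by [].
set g := conic_disc p q s in gE *; move=> p00 p20 g0.
have d02 : 2 * dotq q0 q2 = p0 * s2 + p2 * s0 - g by rewrite gE; ring.
have n1 : normq q1 = p1 * s1 + g.
  have -> : normq q1 = p0 * s2 + p1 * s1 + p2 * s0 - 2 * dotq q0 q2 by rewrite e2; ring.
  by rewrite d02; ring.
pose x := qreal p0 * q1 - qreal p1 * q0; pose d := qreal p0 * q2 - qreal p2 * q0.
have nx : normq x = p0 ^+ 2 * g.
  rewrite normq_lincomb n1 -e0 (_ : 2 * dotq q1 q0 = p0 * s1 + p1 * s0); first by ring.
  by rewrite e1 /dotq; ring.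
have nd : normq d = p0 * p2 * g.
  rewrite normq_lincomb -e4 -e0 (_ : 2 * dotq q2 q0 = p0 * s2 + p2 * s0 - g); first by ring.
  by rewrite -d02 /dotq; ring.
have dxd : 2 * dotq x d = p0 * p1 * g.
  rewrite dotq_lincomb -e3 -e1 d02 -e0; ring.
(* The quaternion [l] is [x / d], that is, [mu / n]. *)
pose n := normq d; pose mu := x * qconj d.
have n0 : n != 0 by rewrite /n nd !mulf_neq0.
have nmu : normq mu = p0 ^+ 2 * g * n by rewrite normqM normq_conj nx.
have mu_conj : qreal p2 * qconj mu = qreal (n * p1) - qreal p2 * mu.
  have -> : n * p1 = p2 * (2 * dotq x d) by rewrite dxd /n nd; ring.
  exact: qconj_mul_trace.
have mid : qreal p0 * (mu * q2) + qreal p2 * qconj mu * q0 = qreal (n * p0) * q1.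
  have -> : qreal (n * p0) * q1 = x * (qconj d * d) + qreal (n * p1) * q0.
    by rewrite qconj_mul -/n /x lincomb_mulr.
  have -> : x * (qconj d * d) = mu * (qreal p0 * q2 - qreal p2 * q0) by rewrite mulrA.
  by rewrite mulrBr !qrealCA mu_conj mulrBl addrA addrAC -!mulrA.
pose N := n ^+ 2 * p0; have N0 : N != 0 by rewrite mulf_neq0 ?expf_neq0.
pose a := lin2 (qreal (n * p0)) (qreal p2 * mu).
pose b := lin2 (qreal n * q0) (mu * q2).
have na : normq a = N%:P * p.
  rewrite normq_lin2; apply/polyP => i; rewrite !coefD coefC coefXM coefXnM !coefC coefCM.
  have p3 : (size p <= 3)%N by case: dx.
  case: i => [|[|[|i]]] /=; rewrite ?addr0 ?add0r.
  - by rewrite normq_real /N -/p0; ring.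
  - have -> : 2 * dotq (qreal (n * p0)) (qreal p2 * mu) = n * p0 * (p2 * (2 * dotq x d)).
      by rewrite /mu; norm_ring.
    by rewrite dxd /N /n nd -/p1; ring.
  - by rewrite normqM normq_real nmu /N /n nd -/p2; ring.
  - by rewrite nth_default ?mulr0 // (leq_trans p3).
have ab : qconj a * b = qreal N%:P * q.
  have q3 : forall i, (2 < i)%N -> coefq i q = 0.
    case: dx => _ [h0 h1 h2 h3] _ i i2.
    by apply: quat_ext; rewrite /= nth_default // (leq_trans _ i2).
  have qc : qconj (qreal p2 * mu) = qreal p2 * qconj mu.
    by rewrite qconjM qconj_real qrealC.
  apply: coefq_inj => i; rewrite qconj_lin2 qconj_real qc coefq_lin2M !coefq_lin2.
  have -> : qreal N%:P = qlift (qreal N) :> quat U by rewrite /qlift qmap_real.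
  rewrite coefq_liftM.
  case: i => [|[|[|i]]]; rewrite ?coefq_lin2.
  - by rewrite addr0 mulrA -rmorphM /N; congr (qreal _ * _); ring.
  - transitivity (qreal n * (qreal p0 * (mu * q2) + qreal p2 * qconj mu * q0)).
      by rewrite mulrDr (qrealCA n) (mulrA (qreal n) (qreal p0)) -rmorphM.
    by rewrite mid mulrA -rmorphM /N; congr (qreal _ * _); ring.
  - rewrite mulr0 add0r -mulrA (mulrA (qconj mu)) qconj_mul nmu mulrA -rmorphM.
    by congr (qreal _ * _); rewrite /N /n nd; ring.
  - by rewrite q3 // !mulr0 addr0.
exists N, (qreal (n * p0)), (qreal p2 * mu), (qreal n * q0), (mu * q2); split=> //; split=> //.
have NU : N%:P != 0 :> U by rewrite polyC_eq0.
have p_neq0 : p != 0 by apply: contra_neq p00 => h; rewrite /p0 h coef0.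
apply: (mulfI (_ : N%:P * p != 0)); first by rewrite mulf_neq0.
rewrite -/a -/b -{1}na -[normq a]normq_conj -normqM ab normqM normq_real -E; ring.
Qed.

End NormEquation.

End Conics.

Lemma bezout3 (K : fieldType) (f0 f1 f2 : {poly K}) : exists c l0 l1 l2 g0 g1 g2,
  [/\ l0 * f0 + l1 * f1 + l2 * f2 = c, f0 = c * g0, f1 = c * g1 & f2 = c * g2].
Proof.
have [[u1 u2] /= hu] := Bezoutp f1 f2; set d := u1 * f1 + u2 * f2 in hu.
have [[w1 w2] /= hw] := Bezoutp f0 d; set c := w1 * f0 + w2 * d in hw.
have dv (x y : {poly K}) : x %| y -> exists z, y = x * z.
  by case/dvdpP => z ->; exists z; rewrite mulrC.
have [g0 e0] : exists z, f0 = c * z by apply: dv; rewrite (eqp_dvdl _ hw) dvdp_gcdl.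
have cd : c %| d by rewrite (eqp_dvdl _ hw) dvdp_gcdr.
have [g1 e1] : exists z, f1 = c * z.
  by apply: dv; rewrite (dvdp_trans cd) // (eqp_dvdl _ hu) dvdp_gcdl.
have [g2 e2] : exists z, f2 = c * z.
  by apply: dv; rewrite (dvdp_trans cd) // (eqp_dvdl _ hu) dvdp_gcdr.
exists c, w1, (w2 * u1), (w2 * u2), g0, g1, g2; split=> //.
by rewrite /c /d; ring.
Qed.

Section NormEquation.
Variable F : rcfType.
Local Notation V := {poly F}.
Local Notation U := {poly {poly F}}.
Implicit Types (p s : U) (q : quat U).

(** When the coefficient vectors are proportional over the field of fractions, the triple is
    a scalar polynomial times a triple in the inner variable; that triple is found by
    a Bezout relation between the coefficients of [p]. *)
Lemma proportional_coefs_good p q s : p != 0 -> (size p <= 3)%N -> p * s = normq q ->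
  (forall i j, qreal p`_i * coefq j q = qreal p`_j * coefq i q) -> good p q s.
Proof.
move=> p0 p3 E prop.
have [c [l0 [l1 [l2 [g0 [g1 [g2 [bez e0 e1 e2]]]]]]]] := bezout3 p`_0 p`_1 p`_2.
have [P pE] : exists P, p = c%:P * P.
  apply: dvd_coefs => -[|[|[|i]]]; rewrite ?e0 ?e1 ?e2 ?dvdp_mulr //.
  by rewrite nth_default ?dvdp0 // (leq_trans p3).
have P0 : P != 0 by apply: contra_neq p0 => h; rewrite pE h mulr0.
have c0 : c != 0 by apply: contra_neq p0 => h; rewrite pE h polyC0 mul0r.
have cU : c%:P != 0 :> U by rewrite polyC_eq0.
have [xq xqE] : exists xq,
    xq = qreal l0 * coefq 0 q + qreal l1 * coefq 1 q + qreal l2 * coefq 2 q by eexists.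
pose xs := l0 * s`_0 + l1 * s`_1 + l2 * s`_2.
have qE : q = qlift xq * qreal P.
  apply: (qrealI cU) => /=; rewrite -(qrealCA c%:P) -rmorphM -pE.
  have -> : qreal c%:P = qlift (qreal c) :> quat U by rewrite /qlift qmap_real.
  apply: coefq_inj => i; rewrite !coefq_liftM coefq_real -bez !rmorphD /= !rmorphM /=.
  rewrite !mulrDl -!mulrA (prop 0 i) (prop 1 i) (prop 2 i) !(qrealCA p`_i) -!mulrDr.
  by rewrite -xqE -qrealC.
have EP : c%:P * s = (normq xq)%:P * P.
  apply: (mulfI P0); rewrite mulrA (mulrC P) -pE E qE normqM normq_real /qlift normq_map.
  by ring.
have gb : l0 * P`_0 + l1 * P`_1 + l2 * P`_2 = 1.
  apply: (mulfI c0); rewrite mulr1 -[RHS]bez pE !coefCM; ring.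
have cxs : c * xs = normq xq.
  rewrite -[RHS]mulr1 -gb.
  have h i : c * s`_i = normq xq * P`_i by rewrite -!coefCM EP.
  by rewrite /xs !mulrDr !(mulrCA c) !h; ring.
have sE : s = xs%:P * P.
  by apply: (mulfI cU); rewrite EP -cxs rmorphM mulrA.
have [|C1 [C2 [B [d [f1 f2 f3]]]]] := @one_variable_factor F c xs%:P xq 0 c0.
  by rewrite -rmorphM cxs normq_lin2 normq0 /dotq /= !mulr0 !addr0 !mulr0 !addr0.
exists (qlift C1), B, (qlift C2), (d%:P * P); split.
- by rewrite qE rmorphM mulrA -f1 /lin2 /qlift rmorph0 mulr0 addr0.
- by rewrite /qlift !normq_map pE {1}f2 !rmorphM mulrA.
- by rewrite sE f3 mulrA.
Qed.

Let aV := anisotropic_poly (@anisotropic_real F).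

Section Degenerate.
Variables (p s : U) (q : quat U).
Hypothesis dx : triple_in (fun r => size r <= 3)%N p q s.
Hypothesis E : p * s = normq q.
Local Notation q0 := (coefq 0 q).
Local Notation q1 := (coefq 1 q).
Local Notation q2 := (coefq 2 q).

Lemma degenerate_conic_good : conic_disc p q s = 0 -> p != 0 -> good p q s.
Proof.
have [e0 e1 e2 e3 e4] := norm_equation_coefs dx E.
move=> g0 p0; have p3 : (size p <= 3)%N by case: dx.
have d02 : 2 * dotq q0 q2 = p`_0 * s`_2 + p`_2 * s`_0.
  by apply/eqP; rewrite eq_sym -subr_eq0; apply/eqP.
have n1 : normq q1 = p`_1 * s`_1.
  have -> : normq q1 = (normq q1 + 2 * dotq q0 q2) - 2 * dotq q0 q2 by ring.
  by rewrite -e2 d02; ring.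
have dC (x y : quat V) : dotq x y = dotq y x by norm_ring.
have h01 : qreal p`_0 * q1 = qreal p`_1 * q0.
  apply/eqP; rewrite -subr_eq0; apply/eqP/aV.
  rewrite normq_lincomb (dC q1) -e1 n1 -e0; ring.
have h02 : qreal p`_0 * q2 = qreal p`_2 * q0.
  apply/eqP; rewrite -subr_eq0; apply/eqP/aV.
  rewrite normq_lincomb (dC q2) d02 -e0 -e4; ring.
have h12 : qreal p`_1 * q2 = qreal p`_2 * q1.
  apply/eqP; rewrite -subr_eq0; apply/eqP/aV.
  rewrite normq_lincomb (dC q2) -e3 n1 -e4; ring.
have qz i : coefq i.+3 q = 0.
  case: dx => _ [d0 d1 d2 d3] _.
  by apply: quat_ext; rewrite /= nth_default // (leq_trans _ (_ : 3 <= i.+3)%N).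
have pz i : p`_i.+3 = 0 by rewrite nth_default // (leq_trans p3).
apply: proportional_coefs_good => // i j.
case: i => [|[|[|i]]]; case: j => [|[|[|j]]]; rewrite ?qz ?pz ?rmorph0 ?mul0r ?mulr0 //.
Qed.

End Degenerate.

Lemma generic_conic_moebius_good p q s : triple_in (fun r => size r <= 3)%N p q s ->
  triple_in (ydeg_le 3) p q s -> p * s = normq q ->
  p`_0 != 0 -> p`_2 != 0 -> conic_disc p q s != 0 -> moebius_good p q s.
Proof.
move=> dx dy E p0 p2 g0.
have [N [a0 [a1 [b0 [b1 [N0 rf]]]]]] := conic_row_factor dx E p0 p2 g0.
exact: row_factor_moebius_good N0 dy rf.
Qed.

(** A swap, preceded if necessary by a shift, makes both extreme coefficients of [p]
    nonzero. *)
Lemma norm_equation_moebius_good p q s : triple_in (fun r => size r <= 3)%N p q s ->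
  triple_in (ydeg_le 3) p q s -> p * s = normq q -> moebius_good p q s.
Proof.
move=> dx dy E.
have [p0|p0] := eqVneq p 0.
  by apply: moebius_id; rewrite p0; apply: good0; rewrite -E p0 mul0r.
have [g0|g0] := eqVneq (conic_disc p q s) 0.
  by apply: moebius_id; exact: degenerate_conic_good.
have [p0p2|pp] := boolP ((p`_0 != 0) && (p`_2 != 0)).
  by case/andP: p0p2 => p00 p20; exact: generic_conic_moebius_good.
have swE : s * p = normq (qconj q) by rewrite normq_conj mulrC.
have swg : conic_disc s (qconj q) p = conic_disc p q s.
  by rewrite /conic_disc !coefq_conj; norm_ring.
have dxs := triple_in_swap (@subspace_size F 3) dx.
have dys := triple_in_swap (@subspace_ydeg F 3) dy.
have [s0s2|ss] := boolP ((s`_0 != 0) && (s`_2 != 0)).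
  case/andP: s0s2 => s00 s20; apply: moebius_swap.
  by apply: generic_conic_moebius_good; rewrite ?swg.
(* In the remaining case one of [p], [s] has vanishing constant coefficient and the other
   vanishing leading coefficient, so both of these coefficients of [q] vanish; after
   the shift by 1 those of the new [s] are the sums of those of [p] and [s]. *)
apply: (@moebius_shift _ 1); apply: moebius_swap.
have [e0 e1 e2 e3 e4] := norm_equation_coefs dx E.
set q' := q + _; set s' := s + _ + _.
have E' : p * s' = normq q'.
  rewrite /q' normqD -E normqM normq_real /s'.
  have -> : dotq q (qreal p * qcst 1) = p * dotq q (qcst 1) by norm_ring.
  ring.
have c1 i : coefq i q' = coefq i q + qreal p`_i.
  by rewrite /q' coefqD /qcst /qlift !rmorph1 mulr1 coefq_real.
have s'E i : s'`_i = s`_i + 2 * qre (coefq i q) + p`_i.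
  have -> : s' = s + 2%:P * qre q + p.
    by rewrite /s' /qcst /qlift !rmorph1 normq1 /dotq /= !mulr0 !addr0 mulr1 mul1r rmorph_nat.
  by rewrite !coefD coefCM.
have g' : conic_disc s' (qconj q') p = conic_disc p q s.
  by rewrite /conic_disc !coefq_conj !c1 !s'E; norm_ring.
have zq (x : quat V) : normq x = 0 -> qre x = 0 by move=> /aV ->.
have [s00 s20] : s'`_0 != 0 /\ s'`_2 != 0.
  rewrite !s'E; move: pp ss g0; rewrite !negb_and !negbK /conic_disc.
  have dz (x y : quat V) : normq x = 0 -> dotq x y = 0.
    by move=> /aV ->; norm_ring.
  have dz' (x y : quat V) : normq y = 0 -> dotq x y = 0.
    by move=> /aV ->; norm_ring.
  case/orP=> /eqP pz /orP[] /eqP sz; rewrite pz sz ?(mul0r, mulr0, add0r, addr0).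
  - have n0 : normq (coefq 0 q) = 0 by rewrite -e0 pz mul0r.
    by rewrite dz // mulr0 ?subrr ?oppr0 eqxx.
  - have n0 : normq (coefq 0 q) = 0 by rewrite -e0 pz mul0r.
    have n2 : normq (coefq 2 q) = 0 by rewrite -e4 sz mulr0.
    rewrite dz // mulr0 subr0 mulf_eq0 negb_or => /andP[p20 s00].
    by rewrite (zq _ n0) (zq _ n2) !mulr0 !addr0 !add0r.
  - have n0 : normq (coefq 0 q) = 0 by rewrite -e0 sz mulr0.
    have n2 : normq (coefq 2 q) = 0 by rewrite -e4 pz mul0r.
    rewrite dz // mulr0 subr0 mulf_eq0 negb_or => /andP[p00 s20].
    by rewrite (zq _ n0) (zq _ n2) !mulr0 !addr0 !add0r.
  - have n2 : normq (coefq 2 q) = 0 by rewrite -e4 pz mul0r.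
    by rewrite dz' // mulr0 ?subrr ?oppr0 eqxx.
apply: generic_conic_moebius_good; rewrite ?g' //.
- exact: triple_in_swap (@subspace_size F 3) (triple_in_shift 1 (@subspace_size F 3) dx).
- exact: triple_in_swap (@subspace_ydeg F 3) (triple_in_shift 1 (@subspace_ydeg F 3) dy).
- by rewrite normq_conj mulrC.
Qed.

End NormEquation.

(** * Quaternions of polynomials and polynomials of quaternions *)

Section PolyOfQuat.
Variable S : comNzRingType.
Implicit Types (x y : quat {poly S}).

Definition polyq x : {poly quat S} :=
  \poly_(i < maxn (maxn (size (qre x)) (size (qim_i x)))
                  (maxn (size (qim_j x)) (size (qim_k x))))
    qmap (fun p : {poly S} => p`_i) x.

Lemma coef_polyq x i : (polyq x)`_i = qmap (fun p : {poly S} => p`_i) x.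
Proof.
rewrite coef_poly; case: ltnP => //; rewrite !geq_max => /andP[/andP[h0 h1] /andP[h2 h3]].
by apply: quat_ext; rewrite /= nth_default.
Qed.

Fact polyq_is_zmod_morphism : zmod_morphism polyq.
Proof.
by move=> x y; apply/polyP => i; rewrite coefB !coef_polyq; apply: quat_ext; rewrite /= coefB.
Qed.

Fact polyq_is_monoid_morphism : monoid_morphism polyq.
Proof.
split=> [|x y]; apply/polyP => i.
  rewrite coef_polyq coef1; case: i => [|i]; apply: quat_ext;
  by rewrite /= ?coef1 ?coef0.
rewrite coef_polyq coefM.
have sumE (f : quat S -> S) (G : 'I_i.+1 -> quat S) :
    (forall a b, f (a + b) = f a + f b) -> f 0 = 0 -> f (\sum_j G j) = \sum_j f (G j).
  by move=> fD f0; apply: (big_morph f fD f0).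
by apply: quat_ext; rewrite quatE /= sumE //; rewrite !(coefD, coefB, coefN) !coefM;
  rewrite -!sumrN -!big_split /=;
  apply: eq_bigr => j _; rewrite !coef_polyq quatE.
Qed.

HB.instance Definition _ := GRing.isZmodMorphism.Build (quat {poly S}) {poly quat S} polyq
  polyq_is_zmod_morphism.
HB.instance Definition _ := GRing.isMonoidMorphism.Build (quat {poly S}) {poly quat S} polyq
  polyq_is_monoid_morphism.

End PolyOfQuat.

Section PolyPolyOfQuat.
Variable R : comNzRingType.
Local Notation U := {poly {poly R}}.
Implicit Types (x y : quat U) (p : U) (A : {poly {poly quat R}}).

Definition toHq x : {poly {poly quat R}} := map_poly (@polyq R) (polyq x).

Lemma coef_toHq x i j : (toHq x)`_i`_j = qmap (fun p : U => p`_i`_j) x.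
Proof. by rewrite coef_map /= coef_polyq coef_polyq. Qed.

HB.instance Definition _ := GRing.RMorphism.copy toHq (map_poly (@polyq R) \o @polyq {poly R}).

Lemma toHq_inj : injective toHq.
Proof.
move=> x y h; apply: quat_ext; apply/polyP => i; apply/polyP => j;
  by have := coef_toHq x i j; rewrite h coef_toHq => -[].
Qed.

Lemma toHq_ex A : exists x, A = toHq x.
Proof.
pose g (f : quat R -> R) : U := map_poly (map_poly f) A.
exists (Quat (g (@qre R)) (g (@qim_i R)) (g (@qim_j R)) (g (@qim_k R))).
apply/polyP => i; apply/polyP => j; rewrite coef_toHq; apply: quat_ext; rewrite /= /g;
  by rewrite coef_map_id0 ?map_poly0 // coef_map_id0.
Qed.

Lemma toHqE p : toH p = toHq (qreal p).
Proof.
apply/polyP => i; apply/polyP => j; rewrite coef_toHq /toH !coef_map /=.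
by apply: quat_ext; rewrite /= ?coef0.
Qed.

Lemma conjH_toHq x : conjH (toHq x) = toHq (qconj x).
Proof.
apply/polyP => i; apply/polyP => j; rewrite coef_toHq /conjH coef_map /= coef_map /= coef_toHq.
by apply: quat_ext; rewrite /= ?coefN.
Qed.

HB.instance Definition _ := GRing.RMorphism.copy (@toH R) (map_poly (map_poly (@qreal R))).

Lemma toH_inj : injective (@toH R).
Proof. by move=> p r; rewrite !toHqE => /toHq_inj/qreal_inj. Qed.

Lemma normsqH_toHq x : normsqH (toHq x) = toH (normq x).
Proof. by rewrite /normsqH conjH_toHq -rmorphM mul_qconj toHqE. Qed.

Lemma normsqH_toHqM x y : normsqH (toHq x * toHq y) = toH (normq x * normq y).
Proof. by rewrite -(rmorphM (@toHq)) normsqH_toHq normqM. Qed.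

Lemma normsqH_sub x y z p : (normsqH (toHq x) - normsqH (toHq y * toHq z)) * toH p =
  toH ((normq x - normq y * normq z) * p).
Proof. by rewrite normsqH_toHq normsqH_toHqM [RHS]rmorphM [in RHS]rmorphB. Qed.

Lemma normsqH_add x y z p : (normsqH (toHq x) + normsqH (toHq y * toHq z)) * toH p =
  toH ((normq x + normq y * normq z) * p).
Proof. by rewrite normsqH_toHq normsqH_toHqM [RHS]rmorphM [in RHS]rmorphD. Qed.

Lemma coefCC (T : nzRingType) (a : T) i j :
  (a%:P%:P)`_i`_j = if (i == 0%N) && (j == 0%N) then a else 0.
Proof. by rewrite coefC; case: i => [|i] /=; rewrite ?coef0 ?coefC. Qed.

Lemma constH_toHq (z : quat R) : constH z = toHq (qmap (fun a : R => a%:P%:P) z).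
Proof.
apply/polyP => i; apply/polyP => j; rewrite coef_toHq /constH coefCC /qmap /= !coefCC.
by case: ifP => // _; case: z.
Qed.

Lemma toHq_comp (a b c d : U) :
  toH a + iH * toH b + jH * toH c + kH * toH d = toHq (Quat a b c d).
Proof.
rewrite !toHqE /iH /jH /kH !constH_toHq -!rmorphM -!rmorphD; congr toHq.
by rewrite /qmap /= !rmorph0 !rmorph1; quat_ring.
Qed.

End PolyPolyOfQuat.

(** * Moebius transformations as matrices *)

Section Matrices.
Variable R : realType.
Local Notation U := {poly {poly R}}.
Implicit Types (M : 'M[R]_6) (X : 'cV[U]_6).

Lemma mulmx_col6 (S : pzRingType) (M : 'M[S]_6) (x : 'cV[S]_6) i :
  (M *m x) i 0 = M i 0 * x 0 0 + M i 1 * x 1 0 + M i 2 * x 2 0 + M i 3 * x 3 0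
    + M i 4 * x 4 0 + M i 5 * x 5 0.
Proof.
rewrite mxE !big_ord_recl big_ord0 addr0 !addrA.
by do !congr (_ + _); congr (M _ _ * x _ _); apply: val_inj.
Qed.

Lemma polyC2_mxM m n k (A : 'M[R]_(m, n)) (B : 'M[R]_(n, k)) :
  polyC2_mx (A *m B) = polyC2_mx A *m polyC2_mx B.
Proof. exact: (map_mxM (polyC \o polyC)). Qed.

Lemma polyC2_mx1 n : polyC2_mx (1%:M : 'M[R]_n) = 1%:M.
Proof. exact: (map_mx1 (polyC \o polyC)). Qed.

Lemma preserves_cone_inverse M N : (forall x : 'cV[R]_6, N *m (M *m x) = x) ->
  (forall x : 'cV[R]_6, M *m (N *m x) = x) ->
  (forall x : 'cV[R]_6, cone_eq x -> cone_eq (M *m x)) ->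
  (forall x : 'cV[R]_6, cone_eq x -> cone_eq (N *m x)) ->
  M \in unitmx /\ preserves_cone M.
Proof.
move=> NM MN cM cN; split.
  have /mulmx1_unit[] // : M *m N = 1%:M.
  apply/matrixP => i j.
  have := congr1 (fun c : 'cV[R]_6 => c i 0) (MN (delta_mx j 0)).
  by rewrite /= mulmxA -colE !mxE eqxx andbT.
apply/seteqP; split=> [_ [x cx <-]|x cx]; first exact: cM.
by exists (N *m x); [exact: cN | exact: MN].
Qed.

Definition table_mx (t : seq (seq R)) : 'M[R]_6 := \matrix_(i, j) nth 0 (nth [::] t i) j.

(** In the coordinates [p = x6 - x5], [s = x6 + x5] of the cone, [swap_mx] exchanges [p] and [s]
    and conjugates the quaternion [q] of the first four coordinates, and
    [shift_mx z] sends [q] to [q + p z]. *)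
Definition swap_mx := table_mx
  [:: [:: 1]; [:: 0; -1]; [:: 0; 0; -1]; [:: 0; 0; 0; -1];
      [:: 0; 0; 0; 0; -1]; [:: 0; 0; 0; 0; 0; 1]].

Definition shift_mx (z : quat R) :=
  let: Quat a b c d := z in let h := normq z / 2 in table_mx
  [:: [:: 1; 0; 0; 0; - a; a]; [:: 0; 1; 0; 0; - b; b];
      [:: 0; 0; 1; 0; - c; c]; [:: 0; 0; 0; 1; - d; d];
      [:: a; b; c; d; 1 - h; h]; [:: a; b; c; d; - h; 1 + h]].

Definition pcoord (S : comNzRingType) (x : 'cV[S]_6) : S := x 5 0 - x 4 0.
Definition scoord (S : comNzRingType) (x : 'cV[S]_6) : S := x 5 0 + x 4 0.
Definition qcoord (S : comNzRingType) (x : 'cV[S]_6) : quat S :=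
  Quat (x 0 0) (x 1 0) (x 2 0) (x 3 0).

Lemma cone_coord (S : comNzRingType) (x : 'cV[S]_6) :
  cone_eq x <-> pcoord x * scoord x = normq (qcoord x).
Proof.
rewrite /cone_eq /pcoord /scoord /normq /=.
set a := x 0 0; set b := x 1 0; set c := x 2 0; set d := x 3 0; set e := x 4 0; set f := x 5 0.
split=> h.
  by rewrite (_ : (f - e) * (f + e) = f ^+ 2 - e ^+ 2); [rewrite -h; ring | ring].
by rewrite -h; ring.
Qed.

Section MapMatrices.
Variables (S : comNzRingType) (phi : {rmorphism R -> S}).
Implicit Types (x : 'cV[S]_6).

Lemma swap_mx_coord x (y := map_mx phi swap_mx *m x) :
  [/\ pcoord y = scoord x, qcoord y = qconj (qcoord x) & scoord y = pcoord x].
Proof.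
by rewrite /y /pcoord /scoord /qcoord; split; [|apply: quat_ext|];
  rewrite /= !mulmx_col6 !mxE /= !(rmorph0, rmorph1, rmorphN); ring.
Qed.

Lemma shift_mx_coord z x (y := map_mx phi (shift_mx z) *m x) :
  [/\ pcoord y = pcoord x, qcoord y = qcoord x + qreal (pcoord x) * qmap phi z
    & scoord y = scoord x + 2 * dotq (qcoord x) (qmap phi z)
        + normq (qmap phi z) * pcoord x].
Proof.
have hh : 2 * phi (normq z / 2) = normq (qmap phi z).
  by rewrite normq_map -(rmorph_nat phi) -rmorphM mulrC divfK // pnatr_eq0.
rewrite {}/y -hh; case: z {hh} => a b c d; rewrite /shift_mx; set h := _ / 2.
rewrite /pcoord /scoord /qcoord; split; [|apply: quat_ext|];
  rewrite /dotq ?quatE /= !mulmx_col6 !mxE /= !(rmorph0, rmorph1, rmorphN, rmorphD, rmorphB);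
  ring.
Qed.

End MapMatrices.

Lemma coord_inj (x y : 'cV[R]_6) :
  pcoord x = pcoord y -> qcoord x = qcoord y -> scoord x = scoord y -> x = y.
Proof.
rewrite /pcoord /qcoord /scoord => hp [h0 h1 h2 h3] hs.
have h5 : x 5 0 = y 5 0 by lra.
have h4 : x 4 0 = y 4 0 by lra.
apply/colP => i.
case: i => -[|[|[|[|[|[|//]]]]]] i6.
- by rewrite (_ : Ordinal _ = 0) //; apply: val_inj.
- by rewrite (_ : Ordinal _ = 1) //; apply: val_inj.
- by rewrite (_ : Ordinal _ = 2) //; apply: val_inj.
- by rewrite (_ : Ordinal _ = 3) //; apply: val_inj.
- by rewrite (_ : Ordinal _ = 4) //; apply: val_inj.
- by rewrite (_ : Ordinal _ = 5) //; apply: val_inj.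
Qed.

Lemma swap_mx_preserves : swap_mx \in unitmx /\ preserves_cone swap_mx.
Proof.
have H (x : 'cV[R]_6) : [/\ pcoord (swap_mx *m x) = scoord x,
    qcoord (swap_mx *m x) = qconj (qcoord x) & scoord (swap_mx *m x) = pcoord x].
  by have := swap_mx_coord idfun x; rewrite map_mx_id //.
have K (x : 'cV[R]_6) : swap_mx *m (swap_mx *m x) = x.
  have [h1 h2 h3] := H x; have [k1 k2 k3] := H (swap_mx *m x).
  by apply: coord_inj; rewrite ?k1 ?k2 ?k3 ?h1 ?h2 ?h3 ?qconjK.
have P (x : 'cV[R]_6) : cone_eq x -> cone_eq (swap_mx *m x).
  by move=> /cone_coord cx; apply/cone_coord; have [-> -> ->] := H x; rewrite normq_conj mulrC.
exact: preserves_cone_inverse.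
Qed.

Lemma shift_mx_preserves z : shift_mx z \in unitmx /\ preserves_cone (shift_mx z).
Proof.
have H (w : quat R) (x : 'cV[R]_6) : [/\ pcoord (shift_mx w *m x) = pcoord x,
    qcoord (shift_mx w *m x) = qcoord x + qreal (pcoord x) * w
  & scoord (shift_mx w *m x) = scoord x + 2 * dotq (qcoord x) w + normq w * pcoord x].
  have := shift_mx_coord idfun w x; rewrite map_mx_id //.
  by have -> : qmap idfun w = w by case: w.
have K : forall (w : quat R) (x : 'cV[R]_6), shift_mx (- w) *m (shift_mx w *m x) = x.
  move=> w x.
  have [h1 h2 h3] := H w x; have [k1 k2 k3] := H (- w) (shift_mx w *m x).
  apply: coord_inj; first by rewrite k1 h1.
    by rewrite k2 h2 h1 mulrN addrK.
  by rewrite k3 h1 h2 h3; norm_ring.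
have P (w : quat R) (x : 'cV[R]_6) : cone_eq x -> cone_eq (shift_mx w *m x).
  move=> /cone_coord cx; apply/cone_coord; have [-> -> ->] := H w x.
  rewrite normqD -cx normqM normq_real.
  have -> : dotq (qcoord x) (qreal (pcoord x) * w) = pcoord x * dotq (qcoord x) w by norm_ring.
  by ring.
apply: (@preserves_cone_inverse _ (shift_mx (- z))) => //.
  by move=> x; rewrite -{1}[z]opprK.
by move=> x; exact: P.
by move=> x; exact: P.
Qed.

Lemma preserves_coneM M N : preserves_cone M -> preserves_cone N -> preserves_cone (M *m N).
Proof.
rewrite /preserves_cone => hM hN; rewrite -[RHS]hM -[in RHS]hN image_comp.
by apply: eq_imagel => x _; rewrite /= mulmxA.
Qed.

Lemma preserves_cone1 : preserves_cone (1%:M : 'M[R]_6).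
Proof.
by apply/seteqP; split=> [_ [x cx <-]|x cx]; [rewrite /= mul1mx | exists x; rewrite ?mul1mx].
Qed.

Lemma moebius_good_matrix p q s X : moebius_good p q s ->
    pcoord X = p -> qcoord X = q -> scoord X = s ->
  exists M, [/\ M \in unitmx, preserves_cone M &
    let Y := polyC2_mx M *m X in good (pcoord Y) (qcoord Y) (scoord Y)].
Proof.
move=> h; elim: h X => {p q s} [p q s g|p q s _ IH|z p q s _ IH] X hp hq hs.
- exists 1%:M; rewrite unitmx1 polyC2_mx1 mul1mx /= hp hq hs; split=> //.
  exact: preserves_cone1.
- have [k1 k2 k3] := swap_mx_coord (polyC \o polyC) X.
  have [uS pS] := swap_mx_preserves.
  have [||| M [uM pM g]] := IH (polyC2_mx swap_mx *m X); rewrite ?k1 ?k2 ?k3 ?hp ?hq ?hs //.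
  exists (M *m swap_mx); rewrite unitmx_mul uM uS polyC2_mxM -mulmxA; split=> //.
  exact: preserves_coneM.
- have [k1 k2 k3] := shift_mx_coord (polyC \o polyC) z X.
  have zE : qmap (polyC \o polyC) z = qcst z :> quat U by [].
  have [uS pS] := shift_mx_preserves z.
  have [||| M [uM pM g]] := IH (polyC2_mx (shift_mx z) *m X);
    rewrite ?k1 ?k2 ?k3 ?zE ?hp ?hq ?hs //.
  exists (M *m shift_mx z); rewrite unitmx_mul uM uS polyC2_mxM -mulmxA; split=> //.
  exact: preserves_coneM.
Qed.

End Matrices.

(** * Bidegrees *)

Lemma bideg_leP (S : nzRingType) m n (A : {poly {poly S}}) :
  reflect ((size A <= m.+1)%N /\ (forall i, (size (A`_i)%R <= n.+1)%N)) (bideg_le m n A).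
Proof.
apply: (iffP andP) => -[h1 h2]; split=> //.
  by move=> i; apply: leq_trans h2; exact: max_size_coefXY.
by apply/bigmax_leqP => i _; exact: h2.
Qed.

Section Bidegree.
Variable F : rcfType.
Local Notation U := {poly {poly F}}.
Implicit Types (p s f g : U) (q x : quat U).

Lemma bideg_factor m n f g : f * g != 0 -> bideg_le m n (f * g) -> bideg_le m n f.
Proof.
have szM (a b : U) : a * b != 0 -> (size a <= size (a * b)%R)%N.
  rewrite mulf_eq0 negb_or => /andP[a0 b0]; rewrite size_mul //.
  by rewrite -subn1 -addnBA ?leq_addr // size_poly_gt0.
move=> fg0 /andP[h1 h2]; rewrite /bideg_le (leq_trans (szM _ _ fg0) h1) /=.
move: h2; rewrite !sizeYE rmorphM /= => h2; rewrite (leq_trans (szM _ _ _) h2) //.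
by rewrite -rmorphM /= swapXY_eq0.
Qed.

Definition qbideg_le m n x : Prop := [/\ bideg_le m n (qre x), bideg_le m n (qim_i x),
  bideg_le m n (qim_j x) & bideg_le m n (qim_k x)].

Lemma bideg_normq m n x : bideg_le (m + m) (n + n) (normq x) -> qbideg_le m n x.
Proof.
have aV := anisotropic_poly (@anisotropic_real F).
move=> /andP[/(size_normq aV)/and4P[h0 h1 h2 h3]].
rewrite sizeYE => hY.
have /(size_normq aV)/and4P[/= k0 k1 k2 k3] :
  (size (normq (qmap (@swapXY F) x)) <= (n + n).+1)%N by rewrite normq_map.
by rewrite /qbideg_le /bideg_le !sizeYE; split; apply/andP.
Qed.

Lemma bideg_toHq m n x : qbideg_le m n x -> bideg_le m n (toHq x).
Proof.
case=> /bideg_leP[s0 y0] /bideg_leP[s1 y1] /bideg_leP[s2 y2] /bideg_leP[s3 y3].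
apply/bideg_leP; split=> [|i]; apply/leq_sizeP => j mj.
  have z (f : U) : (size f <= m.+1)%N -> f`_j = 0.
    by move=> h; rewrite nth_default // (leq_trans h mj).
  by apply/polyP => k; rewrite coef_toHq coef0 /qmap /= !z ?coef0.
have z (f : U) : (size (f`_i)%R <= n.+1)%N -> f`_i`_j = 0.
  by move=> h; rewrite nth_default // (leq_trans h mj).
by rewrite coef_toHq /qmap /= !z.
Qed.

Lemma bideg_subspace m n : subspace (fun p : U => bideg_le m n p).
Proof.
split=> [p s /bideg_leP[p1 p2] /bideg_leP[s1 s2]|c p /bideg_leP[p1 p2]]; apply/bideg_leP.
  by split; [exact: (subspace_size _ _).1 | exact: (subspace_ydeg _ _).1].
by split; [exact: (subspace_size _ _).2 | exact: (subspace_ydeg _ _).2].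
Qed.

Lemma bideg_const m n (c : F) : bideg_le m n (c%:P%:P : U).
Proof.
apply/bideg_leP; split=> [|i]; first by rewrite (leq_trans (size_polyC_leq1 _)).
by rewrite coefC; case: ifP => _; rewrite ?size_poly0 // (leq_trans (size_polyC_leq1 _)).
Qed.

Lemma two_half : 2 * (2^-1)%:P%:P = 1 :> U.
Proof. by rewrite -(rmorph_nat (polyC \o polyC)) -rmorphM mulfV ?pnatr_eq0 // !rmorph1. Qed.

Lemma good_bideg p q s : good p q s -> bideg_le 2 2 p -> bideg_le 2 2 s ->
  exists (A B C : quat U) (D : U),
    [/\ [/\ qbideg_le 1 1 A, qbideg_le 1 1 B, qbideg_le 1 1 C & bideg_le 2 2 D],
      q = qreal 2 * A * B * C * qreal D, p = 2 * (normq A * normq C * D)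
    & s = 2 * (normq B * D)].
Proof.
move=> [A [B [C [D [qE pE sE]]]]] dp ds.
have aU := anisotropic_poly (anisotropic_poly (@anisotropic_real F)).
pose k : U := (2^-1)%:P%:P.
have k2 : 2 * k = 1.
  exact: two_half.
have dk f : bideg_le 2 2 f -> bideg_le 2 2 (k * f) by exact: (bideg_subspace 2 2).2.
have q_const (c : F) : qbideg_le 1 1 (qreal c%:P%:P).
  by split=> /=; rewrite -?polyC0; exact: bideg_const.
have q1 : qbideg_le 1 1 1 by have := q_const 1; rewrite !polyC1 rmorph1.
have q0 : qbideg_le 1 1 0 by have := q_const 0; rewrite !polyC0 rmorph0.
have z5 (x y z w : quat U) : x * 0 * y * z * w = 0 by rewrite mulr0 !mul0r.
have z4 (x y z : quat U) : x * 0 * y * z = 0 by rewrite mulr0 !mul0r.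
have nq : p * s = normq q by rewrite qE pE sE !normqM normq_real; ring.
have [p0|p0] := eqVneq p 0.
  have qz : q = 0 by apply: aU; rewrite -nq p0 mul0r.
  exists 0, 1, 1, (k * s); split; rewrite ?qz ?p0 ?normq0 ?normq1; first by split; rewrite ?dk.
  - by rewrite z5.
  - by rewrite !mul0r mulr0.
  - by rewrite mul1r mulrA k2 mul1r.
have [s0|s0] := eqVneq s 0.
  have qz : q = 0 by apply: aU; rewrite -nq s0 mulr0.
  exists 1, 0, 1, (k * p); split; rewrite ?qz ?s0 ?normq0 ?normq1; first by split; rewrite ?dk.
  - by rewrite z4.
  - by rewrite !mul1r mulrA k2 mul1r.
  - by rewrite mul0r mulr0.
have fac f g : p = f * g -> bideg_le 2 2 f.
  by move=> h; apply: (@bideg_factor _ _ f g); rewrite -h.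
exists A, B, C, (k * D); split.
- split.
  + by apply: (@bideg_normq 1 1); apply: (fac _ (normq C * D)); rewrite mulrA.
  + by apply: (@bideg_normq 1 1); apply: (@bideg_factor _ _ _ D); rewrite -sE.
  + by apply: (@bideg_normq 1 1); apply: (fac _ (normq A * D)); rewrite pE; ring.
  + by apply: dk; apply: (fac _ (normq A * normq C)); rewrite pE mulrC.
- rewrite qE -!mulrA rmorphM /= !(qrealCA k) (mulrA (qreal k)) -rmorphM /=.
  by rewrite (mulrC k) k2 rmorph1 mul1r.
- by rewrite pE mulrCA (mulrA 2) k2 mul1r.
- by rewrite sE mulrCA (mulrA 2) k2 mul1r.
Qed.

End Bidegree.

Lemma poly_eval_eq0 (F : rcfType) (S : idomainType) (phi : {rmorphism F -> S}) (f : {poly S}) :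
  (forall c, f.[phi c] = 0) -> f = 0.
Proof.
move=> h; apply/eqP; apply: contraT => f0.
pose rs := [seq phi i%:R | i <- iota 0 (size f)].
have rs_root : all (root f) rs.
  by apply/allP => _ /mapP[i _ ->]; apply/eqP; exact: h.
have rs_uniq : uniq rs.
  by rewrite map_inj_uniq ?iota_uniq // => i j /fmorph_inj/eqP; rewrite eqr_nat => /eqP.
by have := max_poly_roots f0 rs_root rs_uniq; rewrite size_map size_iota ltnn.
Qed.

Lemma poly2_eval_eq0 (F : rcfType) (f : {poly {poly F}}) :
  (forall c d, f.[c%:P].[d] = 0) -> f = 0.
Proof.
move=> h; apply: (@poly_eval_eq0 F _ (@polyC F)) => c.
by apply: (@poly_eval_eq0 F F idfun) => d; exact: h.
Qed.

(** Conversely, a matrix preserving the real cone pulls the norm equation back: evaluate at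
    real points. *)
Lemma cone_pullback (R : realType) (M : 'M[R]_6) (X : 'cV[{poly {poly R}}]_6) :
  M \in unitmx -> preserves_cone M -> cone_eq (polyC2_mx M *m X) -> cone_eq X.
Proof.
move=> uM pM cY; apply/eqP; rewrite -subr_eq0; apply/eqP.
apply: poly2_eval_eq0 => c d.
pose ev : {rmorphism {poly {poly R}} -> R} := horner_eval d \o horner_eval c%:P.
have evE f : f.[c%:P].[d] = ev f by [].
pose x := map_mx ev X.
have evC (a : R) : ev a%:P%:P = a by rewrite /ev /= /horner_eval !hornerC.
have MxE : map_mx ev (polyC2_mx M *m X) = M *m x.
  rewrite map_mxM; congr (_ *m _); apply/matrixP => i j.
  by rewrite !mxE evC.
have cMx : cone_eq (M *m x).
  by rewrite -MxE /cone_eq !mxE -!rmorphXn -!rmorphD; congr (ev _); move: cY; rewrite /cone_eq !mxE.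
have : [set M *m y | y in [set y | cone_eq y]]%classic (M *m x) by rewrite pM.
case=> y cy /(can_inj (mulKmx uM)) yx; move: cy; rewrite yx /= /cone_eq /x !mxE => cx.
by rewrite evE rmorphB !rmorphD !rmorphXn cx subrr.
Qed.

Theorem theorem1p3 (R : realType) (X : 'cV[{poly {poly R}}]_6)
    (X_deg : forall i, bideg_le 2 2 (X i 0)) :
  cone_eq X <->
  exists M : 'M[R]_6, [/\ M \in unitmx, preserves_cone M &
    let Y := polyC2_mx M *m X in
    exists (A B C : {poly {poly (quat R)}}) (D : {poly {poly R}}),
      [/\ [/\ bideg_le 1 1 A, bideg_le 1 1 B, bideg_le 1 1 C & bideg_le 2 2 D],
          in_Rmn 2 2 (normsqH B * D%:H),
          in_Rmn 2 2 (normsqH (A * C) * D%:H) &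
          [/\ (Y 0 0)%:H + iH * (Y 1 0)%:H + jH * (Y 2 0)%:H + kH * (Y 3 0)%:H
                = 2 * A * B * C * D%:H,
              (Y 4 0)%:H = (normsqH B - normsqH (A * C)) * D%:H &
              (Y 5 0)%:H = (normsqH B + normsqH (A * C)) * D%:H]]].
Proof.
split=> [cX|[M [uM pM [A [B [C [D [_ _ _ [e1 e2 e3]]]]]]]]]; last first.
  apply: (cone_pullback uM pM); apply/cone_coord; rewrite /pcoord /scoord.
  have [a Aa] := toHq_ex A; have [b Bb] := toHq_ex B; have [c Cc] := toHq_ex C.
  move: e1 e2 e3; rewrite {}Aa {}Bb {}Cc; set Y := _ *m X => e1 e2 e3.
  have -> : qcoord Y = 2 * a * b * c * qreal D.
    by apply: toHq_inj; rewrite -toHq_comp e1 toHqE !rmorphM rmorph_nat.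
  have -> : Y 4 0 = (normq b - normq a * normq c) * D.
    by apply: toH_inj; rewrite -normsqH_sub.
  have -> : Y 5 0 = (normq b + normq a * normq c) * D.
    by apply: toH_inj; rewrite -normsqH_add.
  by rewrite !normqM normq_real -(rmorph_nat (@qreal _)) normq_real; ring.
have bd i := elimT (bideg_leP _ _ _) (X_deg i).
have bdD i j : bideg_le 2 2 (X i 0 + X j 0) by exact: (@bideg_subspace R 2 2).1.
have bdN i : bideg_le 2 2 (- X i 0).
  have := (@bideg_subspace R 2 2).2 (-1) _ (X_deg i).
  by rewrite !rmorphN !rmorph1 mulN1r.
have bdp : bideg_le 2 2 (pcoord X) by exact: (@bideg_subspace R 2 2).1.
have bds : bideg_le 2 2 (scoord X) by exact: (@bideg_subspace R 2 2).1.
have dx : triple_in (fun r => size r <= 3)%N (pcoord X) (qcoord X) (scoord X).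
  case/bideg_leP: bdp => ? _; case/bideg_leP: bds => ? _; split=> //.
  by split; [exact: (bd 0).1 | exact: (bd 1).1 | exact: (bd 2).1 | exact: (bd 3).1].
have dy : triple_in (ydeg_le 3) (pcoord X) (qcoord X) (scoord X).
  case/bideg_leP: bdp => _ ?; case/bideg_leP: bds => _ ?; split=> //.
  by split; [exact: (bd 0).2 | exact: (bd 1).2 | exact: (bd 2).2 | exact: (bd 3).2].
have mg := norm_equation_moebius_good dx dy (iffLR (cone_coord X) cX).
have [M [uM pM g]] := moebius_good_matrix mg erefl erefl erefl.
exists M; split=> //; set Y := _ *m X in g *.
have Yd i : bideg_le 2 2 (Y i 0).
  have [hD hZ] := @bideg_subspace R 2 2.
  by rewrite mulmx_col6 !mxE; do 5?[apply: (hD); last exact: (hZ)]; exact: (hZ).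
have YN i : bideg_le 2 2 (- Y i 0).
  have := (@bideg_subspace R 2 2).2 (-1) _ (Yd i).
  by rewrite !rmorphN !rmorph1 mulN1r.
have dp : bideg_le 2 2 (pcoord Y) by exact: (@bideg_subspace R 2 2).1.
have ds : bideg_le 2 2 (scoord Y) by exact: (@bideg_subspace R 2 2).1.
have [A [B [C [D [[dA dB dC dD] qE pE sE]]]]] := good_bideg g dp ds.
have half (f : {poly {poly R}}) : bideg_le 2 2 (2 * f) -> bideg_le 2 2 f.
  move=> h; have := (@bideg_subspace R 2 2).2 2^-1 _ h.
  by rewrite mulrA (mulrC _ 2) two_half mul1r.
have inj2 (f h : {poly {poly R}}) : 2 * f = 2 * h -> f = h.
  by apply: mulfI; rewrite -(rmorph_nat (polyC \o polyC)) /= !polyC_eq0 pnatr_eq0.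
have E4 : Y 4 0 = (normq B - normq A * normq C) * D.
  apply: inj2; transitivity (scoord Y - pcoord Y); first by rewrite /scoord /pcoord; ring.
  by rewrite sE pE; ring.
have E5 : Y 5 0 = (normq B + normq A * normq C) * D.
  apply: inj2; transitivity (scoord Y + pcoord Y); first by rewrite /scoord /pcoord; ring.
  by rewrite sE pE; ring.
exists (toHq A), (toHq B), (toHq C), D; rewrite normsqH_sub normsqH_add.
rewrite normsqH_toHq normsqH_toHqM E4 E5; split=> //.
- by split=> //; exact: bideg_toHq.
- by exists (normq B * D); rewrite ?rmorphM //; apply: half; rewrite -sE.
- by exists (normq A * normq C * D); rewrite ?(rmorphM (@toH R)) //; apply: half; rewrite -pE.
- split=> //; rewrite toHq_comp -[Quat _ _ _ _]/(qcoord Y) qE.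
  by rewrite !rmorphM (rmorph_nat (@qreal _)) rmorph_nat toHqE.
Qed.
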